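(* Let $A\in\mathcal{M}_d(\mathbb{C})$ be self-adjoint, let $\mathcal{X},\mathcal{Y}\subset\mathbb{C}^d$ be subspaces of dimension $k$, and let $\delta>0$ be such that $(A,\mathcal{X},\mathcal{Y},\delta)$ satisfies the DKN separation property. Let $Y\in\mathcal{M}_{d,k}(\mathbb{C})$ have columns forming an orthonormal basis of $\mathcal{Y}$ and let $R_Y=AY-Y(Y^*AY)$. Then $$\delta\,\|\tan(\Theta(\mathcal{X},\mathcal{Y}))\|\le\|P_{\mathcal{X}+\mathcal{Y}}R_Y\|$$ for every unitarily invariant norm $\|\cdot\|$.
   Context: $\mathcal{M}_{d,k}(\mathbb{C})$ is the space of complex $d\times k$ matrices and $\mathcal{M}_d(\mathbb{C})=\mathcal{M}_{d,d}(\mathbb{C})$. $P_{\mathcal{Z}}$ is the orthogonal projection onto $\mathcal{Z}$. For a self-adjoint matrix $C$, $\lambda_i(C)$ are its eigenvalues counted with multiplicity in non-increasing order. DKN (Davis-Kahan-Nakatsukasa) separation property: let $A\in\mathcal{M}_d(\mathbb{C})$ be self-adjoint, let $\mathcal{X},\mathcal{Y}\subset\mathbb{C}^d$ be subspaces with $\dim\mathcal{X}=\dim\mathcal{Y}=k$ and $\mathcal{X}$ $A$-invariant, let $X_\perp\in\mathcal{M}_{d,d-k}(\mathbb{C})$ have columns forming an orthonormal basis of $\mathcal{X}^\perp$ and let $Y\in\mathcal{M}_{d,k}(\mathbb{C})$ have columns forming an orthonormal basis of $\mathcal{Y}$. Given $\delta>0$, $(A,\mathcal{X},\mathcal{Y},\delta)$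 satisfies the DKN separation property if there exist real $a\le b$ such that (1) $\lambda_i(X_\perp^*AX_\perp)\in[a,b]$ for $1\le i\le d-k$, and (2) $\lambda_i(Y^*AY)\in(-\infty,a-\delta]\cup[b+\delta,\infty)$ for $1\le i\le k$. (In particular the $A$-invariance of $\mathcal{X}$ is part of the property. The property implies, by a theorem of Nakatsukasa, that $\Theta_1(\mathcal{X},\mathcal{Y})<\pi/2$.) The principal angles $\Theta(\mathcal{X},\mathcal{Y})=(\Theta_i)_{i=1}^k$, with $\pi/2\ge\Theta_1\ge\dots\ge\Theta_k\ge0$, are defined by $\cos(\Theta_{k-i+1})=s_i(X^*Y)$, where the columns of $X\in\mathcal{M}_{d,k}(\mathbb{C})$ form an orthonormal basis of $\mathcal{X}$ and $s_1\ge\dots\ge s_k$ are singular values; $\tan$ is applied entrywise. A norm on $\mathcal{M}_d(\mathbb{C})$ is unitarily invariant if $\|UBV\|=\|B\|$ for all $B\in\mathcal{M}_d(\mathbb{C})$ and unitary $U,V$. It is applied to $d\times k$ matrices by padding with zeros to size $d\times d$, and to a vector $x\in\mathbb{R}^k$ as the norm of the diagonal matrix with main diagonal $x$ (padded with zeros). *)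

(* Defs.v *)
From HB Require Import structures.
From mathcomp Require Import all_boot all_order all_algebra.
From mathcomp Require Import spectral complex.
From mathcomp Require Import reals trigo.

Set Implicit Arguments.
Unset Strict Implicit.
Unset Printing Implicit Defensive.

Import Order.TTheory GRing.Theory Num.Theory Num.Def.
Local Open Scope ring_scope.
Local Open Scope sesquilinear_scope.
Local Open Scope complex_scope.

Section InnerProduct.
Variables (C : numClosedFieldType) (d : nat).

(* The library's dot product [dotmx] lives on row vectors; [dotcv u v] is
   v^* u, linear in the first argument. *)
Definition dotcv (u v : 'cV[C]_d) : C := dotmx u^T v^T.

Lemma dotcvE u v : dotcv u v = (v^t* *m u) 0 0.
Proof.
rewrite /dotcv dotmxE !mxE; apply: eq_bigr => i _.
by rewrite !mxE mulrC.
Qed.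

Fact dotcv_bilinear : bilinear_for *%R (conjC \; *%R) dotcv.
Proof.
split => [v a x y|u a x y]; rewrite !dotcvE.
  by rewrite mulmxDr -scalemxAr !mxE.
rewrite linearP /= map_mxD map_mxZ mulmxDl -scalemxAl !mxE.
by congr (_ + _); rewrite /= rmorphE.
Qed.

HB.instance Definition _ := bilinear_isBilinear.Build C 'cV[C]_d 'cV[C]_d C
  *%R (conjC \; *%R) dotcv dotcv_bilinear.

Fact dotcv_hermitian u v : dotcv u v = (-1) ^+ false * conjC (dotcv v u).
Proof. exact: hermitian_subproof. Qed.

HB.instance Definition _ :=
  isHermitianSesquilinear.Build C 'cV[C]_d false conjC dotcv dotcv_hermitian.

Fact dotcv_pos (u : 'cV[C]_d) : u != 0 -> 0 < dotcv u u.
Proof. by move=> u0; apply: neq0_dnorm_gt0; rewrite trmx_eq0. Qed.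

HB.instance Definition _ := isDotProduct.Build C 'cV[C]_d dotcv dotcv_pos.

Definition orthonormal_basis (m : nat) (M : 'M[C]_(d, m))
    (V : {vspace 'cV[C]_d}) : Prop :=
  M^t* *m M = 1%:M /\ <<[seq col j M | j <- enum 'I_m]>>%VS = V.

(* The orthogonal projection P_V as a matrix acting on column vectors; the
   library's [proj_ortho] acts on row vectors, hence the transpositions. *)
Definition orthoproj (V : {vspace 'cV[C]_d}) : 'M[C]_d :=
  (proj_ortho (\matrix_(i < \dim V) ((vbasis V)`_i)^T))^T.

Lemma orthoproj_mem V (v : 'cV[C]_d) : orthoproj V *m v \in V.
Proof.
set B := \matrix_(i < \dim V) ((vbasis V)`_i)^T.
have /submxP[D eD] := proj_ortho_sub B v^T.
have -> : orthoproj V *m v = (D *m B)^T by rewrite -eD trmx_mul trmxK.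
rewrite mulmx_sum_row linear_sum memv_suml // => i _.
rewrite linearZ /= memvZ // rowK trmxK.
by rewrite vbasis_mem ?mem_nth ?size_tuple.
Qed.

Lemma orthoproj_compl V (v : 'cV[C]_d) :
  v - orthoproj V *m v \in orthov (@dotcv) V.
Proof.
set B := \matrix_(i < \dim V) ((vbasis V)`_i)^T.
have /orthomx1P/matrixP o := proj_ortho_compl_sub B v^T.
have -> : v - orthoproj V *m v = (v^T - v^T *m proj_ortho B)^T.
  by rewrite linearB /= trmx_mul trmxK.
apply/mem_orthovP => w /coord_vbasis ->; rewrite linear_sumr big1 // => i _.
have := o 0 i; rewrite linearZr_LR /= /dotcv trmxK dotmxE !mxE => oi.
rewrite (_ : \sum_j _ = 0) ?mulr0 // -[RHS]oi.
by apply: eq_bigr => j _; rewrite !mxE.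
Qed.

End InnerProduct.

Section Spectrum.
Variable R : realType.

(* The eigenvalues of a self-adjoint matrix, counted with multiplicity as
   roots of the characteristic polynomial and listed in non-increasing order.
   Taking real parts loses nothing, see [char_poly_eigvals]. *)
Definition eigvals (n : nat) (A : 'M[R[i]]_n) : seq R :=
  sort >=%R [seq complex.Re z | z <-
               sval (closed_field_poly_normal (char_poly A))].

Lemma char_poly_eigvals n (A : 'M[R[i]]_n) : A \is hermsymmx ->
  char_poly A = \prod_(x <- eigvals A) ('X - (x%:C)%:P).
Proof.
move=> hA; rewrite /eigvals; case: closed_field_poly_normal => r /= er.
rewrite (monicP (char_poly_monic A)) scale1r in er.
rewrite (perm_big _ (permEl (perm_sort _ _))) /= big_map er.
apply: eq_big_seq => z zr.
have : eigenvalue A z by rewrite eigenvalue_root_char er root_prod_XsubC.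
case/eigenvalueP => v vA v0; congr ('X - _%:P).
have At : A^t* = A.
  by have := is_hermitianmxP _ _ _ hA; rewrite expr0 scale1r => <-.
have AvT : A *m v^t* = conjC z *: v^t*.
  by rewrite -[in LHS]At -map_mxM -trmx_mul vA linearZ /= map_mxZ.
have : (z - conjC z) * dotmx v v = 0.
  have : z *: (v *m v^t*) = conjC z *: (v *m v^t*).
    by rewrite scalemxAl -vA -mulmxA AvT -scalemxAr.
  move=> /matrixP/(_ 0 0) zz; rewrite mulrBl dotmxE.
  by apply/eqP; rewrite subr_eq0; apply/eqP; move: zz; rewrite mxE [RHS]mxE.
move/eqP; rewrite mulf_eq0 dnorm_eq0 (negPf v0) orbF subr_eq0 => /eqP zz.
by rewrite RRe_real //; apply/CrealP; rewrite -zz.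
Qed.

Lemma size_eigvals n (A : 'M[R[i]]_n) : size (eigvals A) = n.
Proof.
rewrite /eigvals size_sort size_map; case: closed_field_poly_normal => r /= er.
have := size_char_poly A; rewrite er (monicP (char_poly_monic A)) scale1r.
by rewrite size_prod_XsubC => -[].
Qed.

Definition singvals (n : nat) (B : 'M[R[i]]_n) : seq R :=
  [seq Num.sqrt x | x <- eigvals (B^t* *m B)].

(* The principal angles of the column spaces of X and Y, which are meant to
   have orthonormal columns: the cosine of the entry of index j is the
   singular value of index k - 1 - j of X^* Y, so the entries decrease. *)
Definition principal_angles (d k : nat) (X Y : 'M[R[i]]_(d, k)) : 'rV[R]_k :=
  \row_(j < k) acos (singvals (X^t* *m Y))`_(rev_ord j).

(* The eigenvalues do not depend on the choice of the two orthonormal bases,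
   so the existential is equivalent to a universal quantifier. *)
Definition DKN_separation (d k : nat) (A : 'M[R[i]]_d)
    (calX calY : {vspace 'cV[R[i]]_d}) (delta : R) : Prop :=
  {in calX, forall x, A *m x \in calX} /\
  exists (Xperp : 'M[R[i]]_(d, d - k)) (Y : 'M[R[i]]_(d, k)),
    [/\ orthonormal_basis Xperp (orthov (@dotcv _ d) calX),
        orthonormal_basis Y calY &
        exists a b : R,
          [/\ a <= b,
              forall i : 'I_(d - k),
                a <= (eigvals (Xperp^t* *m A *m Xperp))`_i <= b &
              forall i : 'I_k,
                (eigvals (Y^t* *m A *m Y))`_i <= a - delta \/
                b + delta <= (eigvals (Y^t* *m A *m Y))`_i]].

End Spectrum.

Section Norms.
Variable R : realType.

Record unitarily_invariant_norm (d : nat) (N : 'M[R[i]]_d -> R) : Prop := {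
  uinorm_triangle : forall B C, N (B + C) <= N B + N C;
  uinorm_scale : forall (c : R[i]) B, N (c *: B) = Normc.normc c * N B;
  uinorm_eq0 : forall B, N B = 0 -> B = 0;
  uinorm_unitary : forall U B V, U \is unitarymx -> V \is unitarymx ->
    N (U *m B *m V) = N B
}.

(* Zero padding to size d; meant for m <= d and n <= d. *)
Definition pad (d m n : nat) (B : 'M[R[i]]_(m, n)) : 'M[R[i]]_d :=
  \matrix_(i, j)
    match insub (val i), insub (val j) with
    | Some i', Some j' => B i' j'
    | _, _ => 0
    end.

Definition norm_mx (d m n : nat) (N : 'M[R[i]]_d -> R) (B : 'M[R[i]]_(m, n)) :=
  N (pad d B).

Definition norm_vec (d n : nat) (N : 'M[R[i]]_d -> R) (x : 'rV[R]_n) :=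
  N (pad d (diag_mx (map_mx (real_complex R) x))).

End Norms.

(* Main.v *)
(** In suitable orthonormal bases of X and Y one has X^* Y = C := diag(cos), and
    then Y = X C + Q S, Y C - X = F S with S := diag(sin), Q mapping into the
    complement of X and F into the complement of Y inside X + Y.  Since X is
    A-invariant, computing S F^* R_Y and S (Q^* A Q) S and cancelling S gives
      T M = C^-1 (Q^* A Q) S - F^* R_Y,   T := diag(tan), M := Y^* A Y.
    After shifting A by the centre of [a, b], with r := (b - a) / 2, all singular
    values of M are at least r + delta, so that (r + delta) N(T) <= N(T M), while
    Q^* A Q has operator norm at most r.  Since the diagonals of C^-1 and S are
    ordered in the same way, N(C^-1 K S) <= r N(C^-1 S) = r N(T) for every K of
    operator norm at most r: writing both diagonals as nonnegative combinations
    of truncations, a trace estimate shows that the singular values of C^-1 K S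
    are weakly majorized by r T.  Finally F^* R_Y = F^* P R_Y for the projection P
    onto X + Y, so N(F^* R_Y) <= N(P R_Y). *)

Require Import Defs.
From mathcomp Require Import all_boot all_order all_algebra all_fingroup.
From mathcomp Require Import spectral complex.
From mathcomp Require Import reals trigo.
From mathcomp Require Import ring lra.

Set Implicit Arguments.
Unset Strict Implicit.
Unset Printing Implicit Defensive.

Import Order.TTheory GRing.Theory Num.Theory Num.Def.
Local Open Scope ring_scope.
Local Open Scope sesquilinear_scope.
Local Open Scope complex_scope.

(** * Weak majorization for convex functions invariant under permutations and sign changes *)

Section WeakMajorization.
Variables (R : realFieldType) (n : nat) (Phi : 'rV[R]_n -> R).
Hypothesis Phi_convex : forall (a : R) x y, 0 <= a <= 1 ->
  Phi (a *: x + (1 - a) *: y) <= a * Phi x + (1 - a) * Phi y.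
Hypothesis Phi_swap : forall i j (x : 'rV[R]_n), Phi (\row_l x 0 (tperm i j l)) = Phi x.
Hypothesis Phi_sign :
  forall i (x : 'rV[R]_n), Phi (\row_l (if l == i then - x 0 l else x 0 l)) = Phi x.

(** The new vector is a convex combination of [y] and of [y] with the coordinates [j] and [l]
    exchanged, the latter with weight [e / (y 0 j - y 0 l)]. *)
Lemma symmetric_convex_transfer (y : 'rV[R]_n) (j l : 'I_n) (e : R) :
    j != l -> 0 <= e -> e <= y 0 j - y 0 l -> 0 < y 0 j - y 0 l ->
  Phi (\row_i (if i == j then y 0 i - e
               else if i == l then y 0 i + e else y 0 i)) <= Phi y.
Proof.
move=> jl e0 ey yy; set a := e / (y 0 j - y 0 l).
have a01 : 0 <= a <= 1 by rewrite divr_ge0 ?(ltW yy) //= ler_pdivrMr // mul1r.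
have ae : a * (y 0 j - y 0 l) = e by rewrite divfK // gt_eqF.
have := Phi_convex (\row_i y 0 (tperm j l i)) y a01.
rewrite Phi_swap -mulrDl [a + _]addrC subrK mul1r; apply: le_trans.
rewrite le_eqVlt; apply/orP; left; apply/eqP; congr Phi; apply/rowP => i.
rewrite !mxE; case: tpermP => [->|->|/eqP/negPf ij /eqP/negPf il].
- by rewrite eqxx -ae; ring.
- by rewrite eq_sym (negPf jl) eqxx -ae; ring.
- by rewrite ij il; ring.
Qed.

(** Shrinking averages [y] with its reflection in coordinate [j]; the weight [a] of [y] solves
    [(2 a - 1) y_j = b]. *)
Lemma symmetric_convex_shrink (y : 'rV[R]_n) (j : 'I_n) (b : R) :
    0 <= b -> b < y 0 j ->
  Phi (\row_i (if i == j then b else y 0 i)) <= Phi y.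
Proof.
move=> b0 by_; set a := (1 + b / y 0 j) / 2.
have y0 : 0 < y 0 j by exact: le_lt_trans by_.
have by01 : 0 <= b / y 0 j <= 1.
  by rewrite divr_ge0 ?(ltW y0) //= ler_pdivrMr // mul1r ltW.
have a01 : 0 <= a <= 1 by rewrite /a; lra.
have ae : (a * 2 - 1) * y 0 j = b by rewrite /a; field; rewrite gt_eqF.
have := Phi_convex y (\row_i (if i == j then - y 0 i else y 0 i)) a01.
rewrite Phi_sign -mulrDl [a + _]addrC subrK mul1r; apply: le_trans.
rewrite le_eqVlt; apply/orP; left; apply/eqP; congr Phi; apply/rowP => i.
by rewrite !mxE; case: eqP => [->|_]; rewrite -?ae; ring.
Qed.

(* Each step moves [y] towards [x] by a transfer between two coordinates or by
   shrinking one coordinate, and makes one more coordinate agree with [x]. *)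
Lemma symmetric_convex_weak_majorization (x y : 'rV[R]_n) :
    (forall i j : 'I_n, (i <= j)%N -> x 0 j <= x 0 i) ->
    (forall i, 0 <= x 0 i) ->
    (forall i, 0 <= y 0 i) ->
    (forall m, \sum_(i < n | (i < m)%N) x 0 i <= \sum_(i < n | (i < m)%N) y 0 i) ->
  Phi x <= Phi y.
Proof.
(* Induction on the number of coordinates in which [x] and [y] differ. Only [x] is ordered, so a
   transfer in [y] preserves the hypotheses. *)
move=> xdec x0; have [p] := ubnP #|[pred i | x 0 i != y 0 i]|.
elim: p => // p IHp in y *; rewrite ltnS => cardp y0 xy.
have step (y' : 'rV_n) (l : 'I_n) : (forall i, 0 <= y' 0 i) ->
    (forall m, \sum_(i < n | (i < m)%N) x 0 i <=
               \sum_(i < n | (i < m)%N) y' 0 i) ->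
    x 0 l != y 0 l -> x 0 l = y' 0 l ->
    (forall i, x 0 i = y 0 i -> x 0 i = y' 0 i) ->
  Phi x <= Phi y'.
  move=> y'0 xy' xyl xyl' yy'; apply: IHp => //.
  apply: leq_trans cardp; apply: proper_card; apply/properP; split.
    apply/subsetP => i; rewrite !inE; apply: contraNN => /eqP xyi.
    by apply/eqP/yy'.
  by exists l; rewrite !inE // -xyl' eqxx.
case: (pickP [pred l | y 0 l < x 0 l]) => [l0 l0P|noxy]; last first.
  have le_xy i : x 0 i <= y 0 i by rewrite leNgt; have /= -> := noxy i.
  case: (pickP [pred i | x 0 i < y 0 i]) => [i /= xyi|noyx]; last first.
    suff -> : x = y by [].
    by apply/rowP => i; apply/eqP; rewrite eq_le le_xy leNgt; have /= -> := noyx i.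
  apply: le_trans (symmetric_convex_shrink (x0 i) xyi).
  apply: (step _ i) => [j|m||| j xyj]; rewrite ?mxE ?eqxx //.
  - by case: eqP.
  - by apply: ler_sum => j _; rewrite mxE; case: eqP => [->|_].
  - by rewrite lt_eqF.
  - by case: eqP => [->|_].
(* [l] is the first coordinate where [y] falls below [x]. The partial sum up to and including [l]
   forces an earlier [j] where [y] exceeds [x]. *)
case: (@arg_minnP _ l0 [pred l | y 0 l < x 0 l] (@nat_of_ord n) l0P) => l /= xyl lmin.
have le_xy (i : 'I_n) : (i < l)%N -> x 0 i <= y 0 i.
  by move=> il; rewrite leNgt; apply/negP => /lmin; rewrite leqNgt il.
have [j /andP[jl xyj]] : exists j : 'I_n, (j < l)%N && (x 0 j < y 0 j).
  apply/existsP; rewrite -[X in is_true X]negbK; apply/negP => /existsPn noj.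
  have := xy l.+1; rewrite leNgt => /negP; apply.
  rewrite (bigD1 l) //= [X in _ < X](bigD1 l) //=; apply: ltr_leD => //.
  apply: ler_sum => i /andP[]; rewrite ltnS leq_eqVlt val_eqE.
  case/orP => [->//|il _]; have := noj i; rewrite il /=.
  by rewrite -leNgt.
(* The largest transfer that overshoots [x] at neither [j] nor [l]; it makes [y'] agree with [x] at
   one of them. *)
pose e := Num.min (y 0 j - x 0 j) (x 0 l - y 0 l).
have e_gt0 : 0 < e by rewrite lt_min !subr_gt0 xyj.
have ej : e <= y 0 j - x 0 j by rewrite ge_min lexx.
have el : e <= x 0 l - y 0 l by rewrite ge_min lexx orbT.
have xjl : x 0 l <= x 0 j by apply: xdec; exact: ltnW.
have neq_jl : j != l by rewrite -val_eqE ltn_eqF.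
pose y' : 'rV[R]_n := \row_i (if i == j then y 0 i - e
                             else if i == l then y 0 i + e else y 0 i).
have := symmetric_convex_transfer neq_jl (ltW e_gt0) (y := y).
move=> /(_ ltac:(lra) ltac:(lra)); apply: le_trans; rewrite -/y'.
have sum_at m (i0 : 'I_n) : \sum_(i < n | (i < m)%N) (if i == i0 then e else 0) =
    if (i0 < m)%N then e else 0.
  rewrite -big_mkcondr /=; case: ifP => i0m.
    by apply: (big_pred1 i0) => i; rewrite /= andbC; case: eqP => [->|//].
  by apply: big_pred0 => i; rewrite andbC; case: eqP => [->|//].
have y'0 (i : 'I_n) : 0 <= y' 0 i.
  rewrite mxE; case: eqP => [->|_].
    by have := x0 j; lra.
  by case: eqP => // _; rewrite addr_ge0 // ltW.
have xy' m : \sum_(i < n | (i < m)%N) x 0 i <= \sum_(i < n | (i < m)%N) y' 0 i.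
  under [leRHS]eq_bigr => i _.
    have -> : y' 0 i =
      y 0 i - (if i == j then e else 0) + (if i == l then e else 0).
      rewrite mxE; case: eqP => [->|_]; first by rewrite (negPf neq_jl) addr0.
      by case: eqP; rewrite subr0 // addr0.
    over.
  rewrite big_split sumrB !sum_at /=.
  have := xy m; case: ltnP => jm; case: ltnP => lm; rewrite ?subr0 ?addr0 ?subrK//.
    (* Here [j < m <= l]: the transfer has lowered the partial sum, but before [l] each coordinate
       of [y'] still dominates that of [x]. *)
    move=> _; rewrite (bigD1 j) //= [leRHS](_ : _ = y 0 j - e +
      \sum_(i < n | (i < m)%N && (i != j)) y 0 i); last by rewrite (bigD1 j) //= addrAC.
    apply: lerD; first by lra.
    by apply: ler_sum => i /andP[im _]; apply: le_xy; exact: leq_trans lm.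
  by have := ltn_trans jl lm; rewrite ltnNge jm.
have fixed (i : 'I_n) : x 0 i = y 0 i -> x 0 i = y' 0 i.
  move=> xyi; rewrite mxE; case: eqP => [ij|_].
    by move: xyj; rewrite -ij xyi ltxx.
  by case: eqP => [il|//]; move: xyl; rewrite -il xyi ltxx.
have [le_jl|/ltW le_lj] := leP (y 0 j - x 0 j) (x 0 l - y 0 l).
  apply: (step _ j) => //; first by rewrite lt_eqF.
  by rewrite mxE eqxx /e; move/min_idPl: le_jl => ->; rewrite subKr.
apply: (step _ l) => //; first by rewrite gt_eqF.
rewrite mxE eqxx eq_sym (negPf neq_jl) /e; move/min_idPr: le_lj => ->.
by rewrite addrC subrK.
Qed.
End WeakMajorization.

(** * Adjoints, unitary matrices and squared norms *)

Section Adjoint.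
Variable C : numClosedFieldType.

Lemma adjM m n p (A : 'M[C]_(m, n)) (B : 'M[C]_(n, p)) :
  (A *m B)^t* = B^t* *m A^t*.
Proof. by rewrite trmx_mul map_mxM. Qed.

Lemma adjD m n (A B : 'M[C]_(m, n)) : (A + B)^t* = A^t* + B^t*.
Proof. by rewrite linearD /= map_mxD. Qed.

Lemma adjB m n (A B : 'M[C]_(m, n)) : (A - B)^t* = A^t* - B^t*.
Proof. by rewrite linearB /= map_mxB. Qed.

Lemma adj1 n : (1%:M : 'M[C]_n)^t* = 1%:M.
Proof. by rewrite trmx1 map_mx1. Qed.

Lemma unitarymx1 n : (1%:M : 'M[C]_n) \is unitarymx.
Proof. by apply/unitarymxP; rewrite adj1 mulmx1. Qed.

Lemma unitarymx_adj n (U : 'M[C]_n) : U \is unitarymx -> U^t* \is unitarymx.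
Proof. by rewrite trmxC_unitary. Qed.

Lemma unitarymx_adjl n (U : 'M[C]_n) : U \is unitarymx -> U^t* *m U = 1%:M.
Proof. by rewrite -trmxC_unitary => /unitarymxP; rewrite trmxCK. Qed.

Lemma adjl_unitarymx n (U : 'M[C]_n) : U^t* *m U = 1%:M -> U \is unitarymx.
Proof. by move=> UU; rewrite -trmxC_unitary; apply/unitarymxP; rewrite trmxCK. Qed.

Lemma perm_unitarymx n (s : 'S_n) : (perm_mx s : 'M[C]_n) \is unitarymx.
Proof.
by apply/unitarymxP; rewrite tr_perm_mx map_perm_mx -perm_mxM mulgV perm_mx1.
Qed.

Lemma isometry_mulmx d k n (X : 'M[C]_(d, k)) (W : 'M[C]_(k, n)) :
  X^t* *m X = 1%:M -> W^t* *m W = 1%:M -> (X *m W)^t* *m (X *m W) = 1%:M.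
Proof. by move=> XX WW; rewrite adjM -mulmxA (mulmxA (X^t*)) XX mul1mx. Qed.

Lemma compression_mulmx d k (A : 'M[C]_d) (Y : 'M[C]_(d, k)) (W : 'M[C]_k) :
  (Y *m W)^t* *m A *m (Y *m W) = W^t* *m (Y^t* *m A *m Y) *m W.
Proof. by rewrite adjM !mulmxA. Qed.

Lemma residual_mulmx d k (A : 'M[C]_d) (Y : 'M[C]_(d, k)) (W : 'M[C]_k) :
    W \is unitarymx ->
  A *m (Y *m W) - Y *m W *m ((Y *m W)^t* *m A *m (Y *m W)) =
  (A *m Y - Y *m (Y^t* *m A *m Y)) *m W.
Proof.
move=> /unitarymxP WW; rewrite compression_mulmx mulmxBl mulmxA; congr (_ - _).
by rewrite -!(mulmxA Y) -!(mulmxA (W^t*)) (mulmxA W) WW mul1mx.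
Qed.

Lemma residual_shift d k (A : 'M[C]_d) (Y : 'M[C]_(d, k)) (M : 'M[C]_k) (a : C) :
  (A - a%:M) *m Y - Y *m (M - a%:M) = A *m Y - Y *m M.
Proof. by rewrite mulmxBl mulmxBr -(scalar_mxC a Y) opprB addrA subrK. Qed.

(** The squared Euclidean norm, kept as an element of [C]; all norm bounds are stated between
    squares. *)
Definition sqnm n (v : 'cV[C]_n) : C := (v^t* *m v) 0 0.

Lemma sqnmE n (v : 'cV[C]_n) : sqnm v = \sum_i `|v i 0| ^+ 2.
Proof.
rewrite /sqnm mxE; apply: eq_bigr => i _.
by rewrite !mxE normCKC.
Qed.

Lemma sqnm0 n : sqnm (0 : 'cV[C]_n) = 0.
Proof. by rewrite /sqnm mulmx0 mxE. Qed.

Lemma sqnm_ge0 n (v : 'cV[C]_n) : 0 <= sqnm v.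
Proof. by rewrite sqnmE sumr_ge0 // => i _; rewrite exprn_ge0. Qed.

Lemma sqnm_eq0 n (v : 'cV[C]_n) : sqnm v = 0 -> v = 0.
Proof.
rewrite sqnmE => /eqP; rewrite psumr_eq0 => [/allP v0|i _]; last by rewrite exprn_ge0.
apply/colP => i; rewrite mxE; apply/eqP.
by have := v0 i; rewrite mem_index_enum sqrf_eq0 normr_eq0 => /(_ isT).
Qed.

Lemma sqnm_isometry m n (Q : 'M[C]_(m, n)) (v : 'cV_n) :
  Q^t* *m Q = 1%:M -> sqnm (Q *m v) = sqnm v.
Proof. by move=> QQ; rewrite /sqnm adjM mulmxA -(mulmxA _ _ Q) QQ mulmx1. Qed.

Lemma adjl_eq0 m n (D : 'M[C]_(m, n)) : D^t* *m D = 0 -> D = 0.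
Proof.
move=> DD; apply/matrixP => i j; suff /colP/(_ i) : col j D = 0 by rewrite !mxE.
apply: sqnm_eq0; rewrite /sqnm colE adjM mulmxA -(mulmxA _ _ D) DD.
by rewrite mulmx0 mul0mx mxE.
Qed.

End Adjoint.

(** * Real diagonal matrices, partial isometries, the spectral theorem and singular values *)

Section RealDiagonal.
Variable R : realType.
Local Notation C := R[i].

Definition dgmx n (x : 'rV[R]_n) : 'M[C]_n := diag_mx (map_mx (real_complex R) x).

Definition indmx n (I : pred 'I_n) : 'M[C]_n := dgmx (\row_j (I j)%:R).

Lemma dgmxM n (x y : 'rV[R]_n) : dgmx x *m dgmx y = dgmx (\row_j (x 0 j * y 0 j)).
Proof.
rewrite /dgmx mulmx_diag; congr diag_mx; apply/rowP => j.
by rewrite !mxE rmorphM.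
Qed.

Lemma adj_dgmx n (x : 'rV[R]_n) : (dgmx x)^t* = dgmx x.
Proof.
rewrite /dgmx tr_diag_mx map_diag_mx; congr diag_mx; apply/rowP => j.
by rewrite !mxE; apply/CrealP; rewrite complex_real.
Qed.

Lemma dgmxZ n (a : R) (x : 'rV[R]_n) : dgmx (a *: x) = a%:C *: dgmx x.
Proof. by rewrite /dgmx map_mxZ linearZ. Qed.

Lemma dgmxD n (x y : 'rV[R]_n) : dgmx (x + y) = dgmx x + dgmx y.
Proof. by rewrite /dgmx map_mxD linearD. Qed.

Lemma dgmx1 n : dgmx (const_mx 1 : 'rV[R]_n) = 1%:M.
Proof. by rewrite /dgmx map_const_mx diag_const_mx. Qed.

Lemma dgmxE n (x : 'rV[R]_n) i j : dgmx x i j = (x 0 i)%:C *+ (i == j).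
Proof. by rewrite /dgmx !mxE. Qed.

Lemma adj_indmx n (I : pred 'I_n) : (indmx I)^t* = indmx I.
Proof. exact: adj_dgmx. Qed.

Lemma indmxE n (I : pred 'I_n) i j : indmx I i j = (I i && (i == j))%:R.
Proof. by rewrite dgmxE mxE rmorph_nat -mulrnA mulnb. Qed.

Lemma indmx_id n (I : pred 'I_n) : indmx I *m indmx I = indmx I.
Proof.
rewrite /indmx dgmxM; congr dgmx; apply/rowP => j; rewrite !mxE.
by case: (I j); rewrite ?mulr0 ?mulr1.
Qed.

Lemma indmxC n (I : pred 'I_n) : 1%:M - indmx I = indmx (predC I).
Proof.
apply/matrixP => i j; rewrite indmxE 3!mxE indmxE /=.
by case: (i == j); case: (I i); rewrite /= ?subrr ?subr0.
Qed.

Lemma indmx_support n (s : 'rV[R]_n) :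
  indmx [pred j | s 0 j != 0] *m dgmx s = dgmx s.
Proof.
rewrite dgmxM; congr dgmx; apply/rowP => j; rewrite !mxE /=.
by case: eqP => [->|_]; rewrite ?mulr0 ?mul1r.
Qed.

(** A rectangular factor [J] of the coordinate projection, [J^* J = indmx I] and [J J^* = 1], which
    makes the rank visible in its size. *)
Definition selmx n (I : pred 'I_n) : 'M[C]_(#|I|, n) := rowsub enum_val 1%:M.

Lemma selmx_adjl n (I : pred 'I_n) : (selmx I)^t* *m selmx I = indmx I.
Proof.
apply/matrixP => i j; rewrite mxE indmxE.
transitivity (\sum_(l in I) (l == i)%:R * (l == j)%:R : C).
  rewrite [RHS]big_enum_val; apply: eq_bigr => l _.
  by rewrite !mxE; congr (_ * _); rewrite rmorph_nat.
case: (boolP (I i)) => Ii /=.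
  rewrite (bigD1 i) //= big1 ?addr0 ?eqxx ?mul1r //.
  by move=> l /andP[_ /negPf ->]; rewrite mul0r.
rewrite big1 // => l lI; case: eqP => [li|]; last by rewrite mul0r.
by move: Ii; rewrite -li; move: lI; rewrite unfold_in => ->.
Qed.

Lemma selmx_adjr n (I : pred 'I_n) : selmx I *m (selmx I)^t* = 1%:M.
Proof.
apply/matrixP => a b; rewrite !mxE (bigD1 (enum_val a)) //= big1 ?addr0.
  rewrite !mxE eqxx mul1r conjC_nat [_ == enum_val a]eq_sym.
  by rewrite (inj_eq enum_val_inj).
by move=> l /negPf la; rewrite !mxE eq_sym la mul0r.
Qed.

Lemma partial_isometry_indmx m n (Q : 'M[C]_(m, n)) (I : pred 'I_n) :
  Q^t* *m Q = indmx I -> Q *m indmx I = Q.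
Proof.
move=> QQ; apply/eqP; rewrite -subr_eq0 -opprB oppr_eq0 -{1}[Q]mulmx1 -mulmxBr.
apply/eqP/adjl_eq0; rewrite adjM -mulmxA (mulmxA _ Q) QQ adjB adj1 adj_indmx.
by rewrite mulmxBr mulmx1 indmx_id subrr mulmx0.
Qed.

(** The left kernel of [Q] has dimension at least the number of indices outside [I]. Orthonormal
    rows [W] chosen in it supply, as [W^*], the columns on which [Q] vanishes. *)
Lemma partial_isometry_extend n (Q : 'M[C]_n) (I : pred 'I_n) :
  Q^t* *m Q = indmx I -> exists2 U, U \is unitarymx & Q = U *m indmx I.
Proof.
move=> QQ; have QI := partial_isometry_indmx QQ.
have rkQ : (\rank (Q^t*) <= #|I|)%N.
  rewrite -QI adjM adj_indmx -selmx_adjl -mulmxA.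
  by apply: leq_trans (mxrankM_maxl _ _) (rank_leq_col _).
have rkK : (#|predC I| <= \rank (kermx Q))%N.
  rewrite mxrank_ker -(mxrank_tr Q) -(mxrank_map conjC) leq_subRL; last first.
    by apply: leq_trans rkQ _; rewrite -[leqRHS]card_ord max_card.
  by rewrite -[leqRHS]card_ord -(cardC I) leq_add.
pose B := row_base (kermx Q); pose W := rowsub (widen_ord rkK) (schmidt B).
have WQ : W *m Q = 0.
  apply/sub_kermxP; apply: submx_trans (rowsub_sub _ _) _.
  by rewrite eqmx_schmidt_free ?row_base_free // eq_row_base.
have SS : schmidt B *m (schmidt B)^t* = 1%:M.
  by apply/unitarymxP/schmidt_unitarymx; exact: rank_leq_col.
have WW : W *m W^t* = 1%:M.
  apply/matrixP => i j; move/matrixP/(_ (widen_ord rkK i) (widen_ord rkK j)): SS.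
  rewrite !mxE -!val_eqE /= => <-; apply: eq_bigr => l _.
  by rewrite !mxE.
set J := selmx (predC I).
have JI : J *m indmx I = 0.
  have : J *m indmx (predC I) = J by rewrite -selmx_adjl mulmxA selmx_adjr mul1mx.
  by rewrite -indmxC mulmxBr mulmx1 => /eqP; rewrite subr_eq addrC -subr_eq subrr => /eqP.
exists (Q + W^t* *m J); last first.
  by rewrite mulmxDl QI -mulmxA JI mulmx0 addr0.
apply: adjl_unitarymx; rewrite adjD adjM trmxCK mulmxDl !mulmxDr QQ.
have QW : Q^t* *m W^t* = 0 by rewrite -adjM WQ trmx0 map_mx0.
rewrite mulmxA QW mul0mx addr0 -!mulmxA WQ mulmx0 add0r (mulmxA W) WW mul1mx.
by rewrite selmx_adjl -indmxC addrC subrK.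
Qed.

(* As [0^-1 = 0], the columns of [Q] with [s 0 j = 0] vanish. *)
Lemma polar_factor m n (Z : 'M[C]_(m, n)) (s : 'rV[R]_n) :
    Z^t* *m Z = dgmx (\row_j (s 0 j ^+ 2)) ->
  let Q := Z *m dgmx (\row_j (s 0 j)^-1) in
  Q^t* *m Q = indmx [pred j | s 0 j != 0] /\ Q *m dgmx s = Z.
Proof.
move=> ZZ Q.
have QQ : Q^t* *m Q = indmx [pred j | s 0 j != 0].
  rewrite adjM adj_dgmx mulmxA -(mulmxA _ _ Z) ZZ !dgmxM; congr dgmx.
  apply/rowP => j; rewrite !mxE /=; case: eqP => [->|/eqP s0].
    by rewrite invr0 !mulr0.
  by rewrite expr2 mulrA mulVf // mul1r divff.
split => //; rewrite -mulmxA dgmxM.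
rewrite (_ : \row_j _ = \row_j (s 0 j != 0)%:R); last first.
  apply/rowP => j; rewrite !mxE; case: eqP => [->|/eqP s0]; first by rewrite mulr0.
  by rewrite mulVf.
set I := [pred j | s 0 j != 0].
rewrite -[dgmx _]/(indmx I).
(* It remains that [Z] vanishes on the columns with [s 0 j = 0]: the Gram matrix of
   [Z (1 - indmx I)] is zero. *)
apply/eqP; rewrite -subr_eq0 -[X in _ - X]mulmx1 -mulmxBr -opprB mulmxN oppr_eq0.
apply/eqP/adjl_eq0; rewrite indmxC adjM adj_dgmx mulmxA -(mulmxA _ _ Z) ZZ !dgmxM.
apply/matrixP => i j; rewrite dgmxE !mxE /=; case: (s 0 i =P 0) => [->|_] /=.
  by rewrite expr0n mulr0 mul0r mul0rn.
by rewrite mulr0 rmorph0 mul0rn.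
Qed.

Lemma char_poly_conj n (P D : 'M[C]_n) : P \in unitmx ->
  char_poly (invmx P *m D *m P) = char_poly D.
Proof.
move=> Pu; pose f := map_mx (@polyC C).
have fM (A B : 'M[C]_n) : f n n (A *m B) = f n n A *m f n n B by rewrite /f map_mxM.
have fV : f n n (invmx P) *m f n n P = 1%:M by rewrite -fM mulVmx // /f map_mx1.
rewrite /char_poly /char_poly_mx.
have -> : 'X%:M - map_mx (@polyC C) (invmx P *m D *m P) =
    f n n (invmx P) *m ('X%:M - f n n D) *m f n n P.
  rewrite mulmxBr mulmxBl -[in RHS]fM -[in RHS]fM; congr (_ - _).
  by rewrite scalar_mxC -mulmxA fV mulmx1.
rewrite !det_mulmx mulrC mulrA -det_mulmx.
by rewrite (mulmx1C fV) det1 mul1r.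
Qed.

Lemma hermsymmxP n (H : 'M[C]_n) : reflect (H^t* = H) (H \is hermsymmx).
Proof.
apply: (iffP (is_hermitianmxP _ _ _)); rewrite expr0 scale1r => e; last by rewrite e.
by rewrite -e.
Qed.

(** The spectral theorem with the eigenvalues in sorted order. The diagonal of any unitary
    diagonalization has the same multiset of entries, by unique factorization of the characteristic
    polynomial, so permuting the rows of the unitary matrix suffices. *)
Lemma hermitian_eigvals n (H : 'M[C]_n) : H \is hermsymmx ->
  exists2 V : 'M[C]_n, V \is unitarymx &
             H = V^t* *m dgmx (\row_j (eigvals H)`_j) *m V.
Proof.
move=> hH; have /orthomx_spectralP := hermitian_normalmx hH.
set P := spectralmx H; set D := spectral_diag H => eH.
have Pu : P \is unitarymx by exact: spectral_unitarymx.
have sz : size (map (real_complex R) (eigvals H)) == n by rewrite size_map size_eigvals.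
have /tuple_permP[p ep] : perm_eq (Tuple sz) [tuple D 0 i | i < n].
  apply: prod_XsubC_eq; rewrite big_map -char_poly_eigvals // eH.
  rewrite char_poly_conj ?unitarymx_unit // char_poly_trig ?diag_mx_is_trig //.
  rewrite big_map big_enum /=; apply: eq_bigr => i _.
  by rewrite mxE eqxx mulr1n.
have Dp (i : 'I_n) : D 0 (p i) = ((eigvals H)`_i)%:C.
  rewrite -(nth_map 0 0) ?size_eigvals //.
  by rewrite [RHS](congr1 (nth 0 ^~ i) ep) -tnth_nth !tnth_mktuple.
exists (row_perm p P).
  apply/unitarymxP; rewrite row_permE adjM mulmxA -(mulmxA _ P) (unitarymxP _) //.
  by rewrite mulmx1 tr_perm_mx map_perm_mx -perm_mxM mulgV perm_mx1.
rewrite [LHS]eH (invmx_unitary Pu) -!mulmxA; apply/matrixP => i j.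
rewrite !mul_diag_mx !mxE (reindex_inj (@perm_inj _ p)) /=; apply: eq_bigr => l _.
by rewrite !mxE Dp.
Qed.

Lemma hermitian_eigvals_shift n (H : 'M[C]_n) (a : R) : H \is hermsymmx ->
  exists2 V : 'M[C]_n, V \is unitarymx &
    H - a%:C%:M = V^t* *m dgmx (\row_j ((eigvals H)`_j - a)) *m V.
Proof.
move=> /hermitian_eigvals[V Vu eH]; exists V => //.
have -> : dgmx (\row_(j < n) ((eigvals H)`_j - a)) =
    dgmx (\row_j (eigvals H)`_j) - a%:C%:M.
  apply/matrixP => i j; rewrite [RHS]mxE [X in _ = _ + X]mxE !dgmxE !mxE rmorphB.
  by rewrite mulrnBl.
rewrite mulmxBr mulmxBl -eH; congr (_ - _).
by rewrite scalar_mxC -mulmxA (unitarymx_adjl Vu) mulmx1.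
Qed.

Lemma sqnm_hermitian_le n (H : 'M[C]_n) (a r : R) (v : 'cV_n) :
    H \is hermsymmx -> (forall i : 'I_n, `|(eigvals H)`_i - a| <= r) ->
  sqnm ((H - a%:C%:M) *m v) <= r%:C ^+ 2 * sqnm v.
Proof.
move=> /(hermitian_eigvals_shift a)[V Vu ->] Hr.
rewrite -!mulmxA sqnm_isometry ?trmxCK ?(unitarymxP _) //.
rewrite -[in leRHS](sqnm_isometry v (unitarymx_adjl Vu)); move: (V *m v) => w.
rewrite !sqnmE mulr_sumr; apply: ler_sum => i _.
rewrite mul_diag_mx !mxE normrM exprMn.
rewrite ler_wpM2r ?exprn_ge0 // normc_def /= expr0n addr0 sqrtr_sqr.
by rewrite lerXn2r ?nnegrE ?ler0c ?lecR ?normr_ge0 // (le_trans _ (Hr i)).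
Qed.

Lemma sqnm_hermitian_ge n (H : 'M[C]_n) (a r : R) (v : 'cV_n) :
    H \is hermsymmx -> 0 <= r -> (forall i : 'I_n, r <= `|(eigvals H)`_i - a|) ->
  r%:C ^+ 2 * sqnm v <= sqnm ((H - a%:C%:M) *m v).
Proof.
move=> /(hermitian_eigvals_shift a)[V Vu ->] r0 Hr.
rewrite -!mulmxA sqnm_isometry ?trmxCK ?(unitarymxP _) //.
rewrite -[in leLHS](sqnm_isometry v (unitarymx_adjl Vu)); move: (V *m v) => w.
rewrite !sqnmE mulr_sumr; apply: ler_sum => i _.
rewrite mul_diag_mx !mxE normrM exprMn.
rewrite ler_wpM2r ?exprn_ge0 // normc_def /= expr0n addr0 sqrtr_sqr.
by rewrite lerXn2r ?nnegrE ?ler0c ?lecR.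
Qed.

Lemma singvals_ge0 n (B : 'M[C]_n) i : 0 <= (singvals B)`_i.
Proof.
have [le_i|lt_i] := leqP (size (eigvals (B^t* *m B))) i.
  by rewrite nth_default // size_map.
by rewrite (nth_map 0) // sqrtr_ge0.
Qed.

Lemma singvals_sorted n (B : 'M[C]_n) i j :
  (i <= j)%N -> (singvals B)`_j <= (singvals B)`_i.
Proof.
move=> le_ij; have [le_j|lt_j] := leqP (size (eigvals (B^t* *m B))) j.
  by rewrite nth_default ?size_map // singvals_ge0.
have lt_i := leq_ltn_trans le_ij lt_j; rewrite !(nth_map 0) // ler_wsqrtr //.
have : sorted >=%R (eigvals (B^t* *m B)).
  by apply: sort_sorted => x y; exact: le_total.
move/(sorted_leq_nth (rev_trans le_trans) lexx 0)/(_ _ _ lt_i lt_j); exact.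
Qed.

Lemma gram_hermsymmx m n (B : 'M[C]_(m, n)) : B^t* *m B \is hermsymmx.
Proof. by apply/hermsymmxP; rewrite adjM trmxCK. Qed.

(** With [V] diagonalizing [B^* B], the columns of [B V^*] are orthogonal with squared norms the
    eigenvalues. Their polar factor is a partial isometry, whose extension to a unitary matrix is
    [U]; this covers singular [B]. *)
Lemma svd n (B : 'M[C]_n) : exists U V : 'M[C]_n, [/\ U \is unitarymx,
  V \is unitarymx & B = U *m dgmx (\row_j (singvals B)`_j) *m V].
Proof.
have [V Vu eB] := hermitian_eigvals (gram_hermsymmx B).
set e := eigvals _ in eB; pose s : 'rV[R]_n := \row_j (singvals B)`_j.
have VV := unitarymxP Vu.
have ZZ : (B *m V^t*)^t* *m (B *m V^t*) = dgmx (\row_j e`_j).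
  by rewrite adjM trmxCK mulmxA -(mulmxA V) eB !mulmxA VV mul1mx -mulmxA VV mulmx1.
have e0 (j : 'I_n) : 0 <= e`_j.
  move/matrixP/(_ j j): ZZ; rewrite dgmxE mxE eqxx mulr1n mxE -ler0c => <-.
  by rewrite sumr_ge0 // => i _; rewrite !mxE -normCKC exprn_ge0.
have ZZs : (B *m V^t*)^t* *m (B *m V^t*) = dgmx (\row_j (s 0 j ^+ 2)).
  rewrite ZZ; congr dgmx; apply/rowP => j.
  by rewrite !mxE (nth_map 0) ?size_eigvals // sqr_sqrtr // e0.
have [QQ Qs] := polar_factor ZZs; have [U Uu eQ] := partial_isometry_extend QQ.
exists U, V; split=> [//|//|]; rewrite -/s.
rewrite -[LHS](mulmxKtV _ Vu (erefl n)) -Qs eQ; congr (_ *m _).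
by rewrite -mulmxA indmx_support.
Qed.
End RealDiagonal.

(** * Operator norm bounds, traces of truncations and layer decompositions *)

Section Lipschitz.
Variable R : realType.
Local Notation C := R[i].

(** For [0 <= r] this says that the operator norm of [K] is at most [r]. *)
Definition lipmx m n (r : R) (K : 'M[C]_(m, n)) : Prop :=
  forall v : 'cV_n, sqnm (K *m v) <= r%:C ^+ 2 * sqnm v.

Lemma lipmx_mul1l m n p (r : R) (K : 'M[C]_(m, n)) (L : 'M[C]_(n, p)) :
  lipmx 1 K -> lipmx r L -> lipmx r (K *m L).
Proof.
move=> K1 Lr v; rewrite -mulmxA (le_trans (K1 _)) //.
by rewrite rmorph1 expr1n mul1r.
Qed.

Lemma lipmx_mul1r m n p (r : R) (K : 'M[C]_(m, n)) (L : 'M[C]_(n, p)) :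
  lipmx r K -> lipmx 1 L -> lipmx r (K *m L).
Proof.
move=> Kr L1 v; rewrite -mulmxA (le_trans (Kr _)) //.
rewrite ler_wpM2l -?rmorphXn ?ler0c ?sqr_ge0 //.
by rewrite (le_trans (L1 _)) // rmorph1 expr1n mul1r.
Qed.

Lemma lipmx_isometry m n (Q : 'M[C]_(m, n)) : Q^t* *m Q = 1%:M -> lipmx 1 Q.
Proof. by move=> QQ v; rewrite sqnm_isometry // rmorph1 expr1n mul1r. Qed.

Lemma lipmx_unitary n (U : 'M[C]_n) : U \is unitarymx -> lipmx 1 U.
Proof. by move=> /unitarymx_adjl; exact: lipmx_isometry. Qed.

Lemma lipmx_indmx n (I : pred 'I_n) : lipmx 1 (indmx R I).
Proof.
move=> v; rewrite rmorph1 expr1n mul1r !sqnmE; apply: ler_sum => i _.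
rewrite mul_diag_mx !mxE; case: (I i); rewrite ?rmorph1 ?mul1r //.
by rewrite rmorph0 mul0r normr0 expr0n exprn_ge0.
Qed.

Lemma lipmx_partial_isometry m n (Q : 'M[C]_(m, n)) (I : pred 'I_n) :
  Q^t* *m Q = indmx R I -> lipmx 1 Q.
Proof.
move=> QQ v; have := lipmx_indmx I v.
by rewrite /sqnm !adjM -!mulmxA (mulmxA (Q^t*)) QQ (mulmxA ((indmx R I)^t*)) adj_indmx indmx_id.
Qed.

(** The entry is one coordinate of the image of the unit vector [e_i]. *)
Lemma lipmx_diag n (r : R) (K : 'M[C]_n) i : 0 <= r -> lipmx r K -> `|K i i| <= r%:C.
Proof.
move=> r0 /(_ (delta_mx i 0)); rewrite -colE !sqnmE [in leRHS](bigD1 i) //=.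
rewrite [X in _ + X]big1 ?addr0 => [|j /negPf ji]; last first.
  by rewrite mxE ji normr0 expr0n.
rewrite mxE !eqxx normr1 expr1n mulr1 => Kr.
rewrite -(@ler_pXn2r _ 2) ?nnegrE ?normr_ge0 ?ler0c //; apply: le_trans Kr.
rewrite (bigD1 i) //= mxE lerDl sumr_ge0 // => j _.
by rewrite exprn_ge0.
Qed.

Definition topmx n (m : nat) : 'M[C]_n := indmx R [pred i : 'I_n | (i < m)%N].

Lemma mxtrace_topmx n m (K : 'M[C]_n) :
  \tr (topmx n m *m K) = \sum_(i < n | (i < m)%N) K i i.
Proof.
rewrite big_mkcond; apply: eq_bigr => i _; rewrite mul_diag_mx !mxE /=.
by case: ifP; rewrite ?rmorph1 ?rmorph0 ?mul1r ?mul0r.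
Qed.

Lemma mxtrace_topmx_le n m (r : R) (K : 'M[C]_n) : 0 <= r -> lipmx r K ->
  `|\tr (topmx n m *m K)| <= \sum_(i < n | (i < m)%N) r%:C.
Proof.
move=> r0 Kr; rewrite mxtrace_topmx (le_trans (ler_norm_sum _ _ _)) //.
by apply: ler_sum => i _; exact: lipmx_diag.
Qed.

(* By cyclicity of the trace any of the three truncations can be put in front,
   so the smallest one decides. *)
Lemma mxtrace_topmx3_le n (m a b : nat) (r : R) (V K W : 'M[C]_n) :
    0 <= r -> lipmx 1 V -> lipmx r K -> lipmx 1 W ->
  `|\tr (topmx n m *m (V *m topmx n a *m K *m topmx n b *m W))| <=
    \sum_(i < n | (i < m)%N) ((i < a) && (i < b))%N%:R * r%:C.
Proof.
move=> r0 V1 Kr W1.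
have top1 c : lipmx 1 (topmx n c) by exact: lipmx_indmx.
(* The right-hand side counts, with weight [r], the indices below the least of [m], [a] and [b]. *)
have -> : \sum_(i < n | (i < m)%N) ((i < a) && (i < b))%N%:R * r%:C =
    \sum_(i < n | (i < minn m (minn a b))%N) r%:C :> C.
  rewrite [RHS]big_mkcond [LHS]big_mkcond; apply: eq_bigr => i _.
  rewrite !leq_min; case: (i < m)%N => //=.
  by case: (_ && _); rewrite ?mul1r ?mul0r.
have VaK := lipmx_mul1l (lipmx_mul1l V1 (top1 a)) Kr.
have bW := lipmx_mul1l (top1 b) W1.
have mV := lipmx_mul1l (top1 m) V1.
have [le_m|lt_m] := leqP m (minn a b).
  by rewrite -mulmxA; exact: mxtrace_topmx_le r0 (lipmx_mul1r VaK bW).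
have [le_ab|lt_ba] := leqP a b.
  have -> : \tr (topmx n m *m (V *m topmx n a *m K *m topmx n b *m W)) =
      \tr (topmx n a *m (K *m (topmx n b *m W) *m (topmx n m *m V))).
    transitivity (\tr (topmx n m *m V *m (topmx n a *m (K *m (topmx n b *m W))))).
      by rewrite !mulmxA.
    by rewrite mxtrace_mulC !mulmxA.
  exact: mxtrace_topmx_le r0 (lipmx_mul1r (lipmx_mul1r Kr bW) mV).
have -> : \tr (topmx n m *m (V *m topmx n a *m K *m topmx n b *m W)) =
    \tr (topmx n b *m (W *m (topmx n m *m (V *m topmx n a *m K)))).
  transitivity (\tr (topmx n m *m (V *m topmx n a *m K) *m (topmx n b *m W))).
    by rewrite !mulmxA.
  by rewrite mxtrace_mulC !mulmxA.
exact: mxtrace_topmx_le r0 (lipmx_mul1l W1 (lipmx_mul1l (top1 m) VaK)).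
Qed.

(** Summation by parts: the coefficient of the initial segment ending at [a] is the drop from [f_a]
    to its successor, nonnegative by monotonicity. *)
Lemma layer_cake n (f : 'rV[R]_n) :
    (forall i j : 'I_n, (i <= j)%N -> f 0 j <= f 0 i) -> (forall i, 0 <= f 0 i) ->
  exists2 al : nat -> R, forall a, 0 <= al a &
    forall i : 'I_n, f 0 i = \sum_(a < n) al a * (i < a.+1)%N%:R.
Proof.
(* [F] continues [f] by the value [0], so the last drop is the last entry of [f] itself. *)
move=> fdec f0; pose F a := if insub a is Some i then f 0 i else 0.
have FE (i : 'I_n) : F i = f 0 i by rewrite /F valK.
have F_ge0 a : 0 <= F a by rewrite /F; case: insubP.
exists (fun a => F a - F a.+1) => [a|i].
  rewrite subr_ge0; have [lt_an|le_na] := ltnP a.+1 n.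
    by rewrite (FE (Ordinal lt_an)) (FE (Ordinal (ltnW lt_an))) fdec //=.
  by rewrite [F a.+1]/F insubF // ltnNge le_na.
rewrite -(big_mkord xpredT (fun a => (F a - F a.+1) * (i < a.+1)%N%:R)).
rewrite (@big_cat_nat _ _ _ i) //= ?(ltnW (ltn_ord i)) // big_nat big1 ?add0r.
  rewrite big_nat (eq_bigr (fun a => - (F a.+1 - F a))).
    rewrite -big_nat sumrN telescope_sumr ?(ltnW (ltn_ord i)) // opprB FE.
    by rewrite /F insubF ?ltnn // subr0.
  by move=> a /andP[ia _]; rewrite ltnS ia mulr1 opprB.
by move=> a /andP[_ ai]; rewrite ltnS leqNgt ai mulr0.
Qed.

Lemma layer_cake_dgmx n (f : 'rV[R]_n) (al : nat -> R) :
    (forall i : 'I_n, f 0 i = \sum_(a < n) al a * (i < a.+1)%N%:R) ->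
  dgmx f = \sum_(a < n) (al a)%:C *: topmx n a.+1.
Proof.
move=> fE; apply/matrixP => i j; rewrite dgmxE fE summxE rmorph_sum -sumrMnl.
apply: eq_bigr => a _; rewrite mxE /topmx indmxE rmorphM rmorph_nat /=.
by case: (i < a.+1)%N; case: (i == j); rewrite ?mulr0 ?mulr1n ?mulr0n ?mulr0 ?mul0rn.
Qed.

Lemma dgmx_perm n (s : 'S_n) (x : 'rV[R]_n) :
  dgmx (\row_l x 0 (s l)) = perm_mx s *m dgmx x *m perm_mx s^-1.
Proof.
rewrite -row_permE -col_permE; apply/matrixP => i j.
by rewrite [in RHS]mxE [in RHS]mxE !dgmxE mxE (inj_eq perm_inj).
Qed.
End Lipschitz.

(** * Unitarily invariant norms: dominance and products with bounded matrices *)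

Section UnitarilyInvariantNorm.
Variables (R : realType) (n : nat) (N : 'M[R[i]]_n -> R).
Hypothesis N_uinorm : unitarily_invariant_norm N.
Local Notation C := R[i].

Lemma uinormZr (a : R) B : 0 <= a -> N (a%:C *: B) = a * N B.
Proof.
move=> a0; rewrite (uinorm_scale N_uinorm) /= expr0n addr0 sqrtr_sqr.
by rewrite ger0_norm.
Qed.

Lemma uinorm_mulUl (U B : 'M[C]_n) : U \is unitarymx -> N (U *m B) = N B.
Proof.
move=> Uu; rewrite -[U *m B]mulmx1.
exact: (uinorm_unitary N_uinorm _ Uu (unitarymx1 _ _)).
Qed.

Lemma uinorm_mulUr (U B : 'M[C]_n) : U \is unitarymx -> N (B *m U) = N B.
Proof.
move=> Uu; rewrite -[B in LHS]mul1mx.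
exact: (uinorm_unitary N_uinorm _ (unitarymx1 _ _) Uu).
Qed.

Lemma uinorm_dgmx_perm (s : 'S_n) (x : 'rV[R]_n) :
  N (dgmx (\row_l x 0 (s l))) = N (dgmx x).
Proof.
by rewrite dgmx_perm; exact: (uinorm_unitary N_uinorm _ (perm_unitarymx _ s) (perm_unitarymx _ s^-1)).
Qed.

(** Fan dominance on diagonal matrices: permuting the diagonal or changing a sign amounts to
    multiplying by unitary matrices, so [N] is a symmetric convex function of the diagonal. *)
Lemma uinorm_weak_majorization (x y : 'rV[R]_n) :
    (forall i j : 'I_n, (i <= j)%N -> x 0 j <= x 0 i) ->
    (forall i, 0 <= x 0 i) ->
    (forall i, 0 <= y 0 i) ->
    (forall m, \sum_(i < n | (i < m)%N) x 0 i <= \sum_(i < n | (i < m)%N) y 0 i) ->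
  N (dgmx x) <= N (dgmx y).
Proof.
apply: (symmetric_convex_weak_majorization (Phi := fun x => N (dgmx x))).
- move=> a u v /andP[a0 a1]; rewrite dgmxD !dgmxZ.
  by rewrite (le_trans (uinorm_triangle N_uinorm _ _)) // !uinormZr ?subr_ge0.
- by move=> i j u; exact: uinorm_dgmx_perm.
- move=> i u; pose e : 'rV[R]_n := \row_l (if l == i then - 1 else 1).
  have <- : dgmx e *m dgmx u = dgmx (\row_l (if l == i then - u 0 l else u 0 l)).
    rewrite dgmxM; congr dgmx; apply/rowP => l; rewrite !mxE.
    by case: eqP; rewrite ?mulN1r ?mul1r.
  apply: uinorm_mulUl; apply/unitarymxP; rewrite adj_dgmx dgmxM -dgmx1.
  congr dgmx; apply/rowP => l; rewrite !mxE.
  by case: eqP; rewrite ?mulrNN mulr1.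
Qed.

(** The singular values of the product are weakly majorized by [r f g]. The common order of [f] and
    [g] matters: it makes both of them combinations of initial segments, which are nested. *)
Lemma uinorm_dgmx_lip_dgmx (r : R) (f g : 'rV[R]_n) (K : 'M[C]_n) :
    (forall i j : 'I_n, (i <= j)%N -> f 0 j <= f 0 i) -> (forall i, 0 <= f 0 i) ->
    (forall i j : 'I_n, (i <= j)%N -> g 0 j <= g 0 i) -> (forall i, 0 <= g 0 i) ->
    0 <= r -> lipmx r K ->
  N (dgmx f *m K *m dgmx g) <= r * N (dgmx (\row_j (f 0 j * g 0 j))).
Proof.
move=> fdec f0 gdec g0 r0 Kr.
pose M := dgmx f *m K *m dgmx g; rewrite -/M.
have [U [V [Uu Vu]]] := svd M.
have := @singvals_sorted _ _ M; have := @singvals_ge0 _ _ M.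
move: (singvals M) => s s0 sdec eM; rewrite {1}eM (uinorm_unitary N_uinorm _ Uu Vu).
rewrite -uinormZr // -dgmxZ; apply: uinorm_weak_majorization.
- by move=> i j ij; rewrite !mxE sdec.
- by move=> i; rewrite mxE.
- by move=> i; rewrite !mxE !mulr_ge0.
move=> m; have [al al0 fE] := layer_cake fdec f0; have [be be0 gE] := layer_cake gdec g0.
(* A partial sum of singular values is the trace of a truncation of [U^* M V^*], expanded over the
   layers of [f] and [g]. *)
have sE : (\sum_(i < n | (i < m)%N) (\row_j s`_j) 0 i)%:C =
    \sum_(a < n) \sum_(b < n) (al a)%:C * (be b)%:C *
    \tr (topmx R n m *m (U^t* *m topmx R n a.+1 *m K *m topmx R n b.+1 *m V^t*)).
  transitivity (\tr (topmx R n m *m dgmx (\row_j s`_j))).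
    rewrite mxtrace_topmx rmorph_sum; apply: eq_bigr => i _.
    by rewrite dgmxE eqxx.
  have -> : dgmx (\row_j s`_j) = U^t* *m M *m V^t*.
    rewrite eM !mulmxA (unitarymx_adjl Uu) mul1mx -mulmxA (unitarymxP Vu).
    by rewrite mulmx1.
  rewrite /M.
  rewrite (layer_cake_dgmx fE) (layer_cake_dgmx gE).
  rewrite !(mulmx_suml, mulmx_sumr) linear_sum [RHS]exchange_big.
  apply: eq_bigr => b _; rewrite !(mulmx_suml, mulmx_sumr) linear_sum /=.
  apply: eq_bigr => a _.
  rewrite -!(scalemxAl, scalemxAr) linearZ /= linearZ /= mulrA.
  by rewrite !(mulmxA (U^t*)).
rewrite -lecR -[leLHS]ger0_norm; last first.
  by rewrite ler0c sumr_ge0 // => i _; rewrite mxE.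
rewrite sE (le_trans (ler_norm_sum _ _ _)) //.
(* The partial sums of [r f g] expand over the same pairs of layers, so the two sides can be
   compared pair by pair. *)
have -> : (\sum_(i < n | (i < m)%N) (r *: \row_j (f 0 j * g 0 j)) 0 i)%:C =
    \sum_(a < n) \sum_(b < n) (al a)%:C * (be b)%:C *
    \sum_(i < n | (i < m)%N) ((i < a.+1) && (i < b.+1))%N%:R * r%:C.
  transitivity (\sum_(i < n | (i < m)%N) \sum_(a < n) \sum_(b < n)
      ((al a)%:C * (be b)%:C * (((i < a.+1) && (i < b.+1))%N%:R * r%:C))).
    rewrite rmorph_sum; apply: eq_bigr => i _; rewrite !mxE fE gE.
    rewrite rmorphM rmorphM !rmorph_sum mulr_suml mulr_sumr /=.
    apply: eq_bigr => a _; rewrite !mulr_sumr; apply: eq_bigr => b _.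
    rewrite !rmorphM !rmorph_nat -mulnb natrM /=; ring.
  rewrite exchange_big; apply: eq_bigr => a _; rewrite exchange_big.
  by apply: eq_bigr => b _; rewrite mulr_sumr.
apply: ler_sum => a _; rewrite (le_trans (ler_norm_sum _ _ _)) //.
apply: ler_sum => b _; rewrite normrM (@ger0_norm _ (_ * _)) ?mulr_ge0 ?ler0c //.
apply: ler_wpM2l; first by rewrite mulr_ge0 ?ler0c.
have Ua := lipmx_unitary (unitarymx_adj Uu).
exact: mxtrace_topmx3_le r0 Ua Kr (lipmx_unitary (unitarymx_adj Vu)).
Qed.

(** By the singular value decomposition of [B], this is the preceding weighted bound with
    [f = 1]. *)
Lemma uinorm_lip_mull (r : R) (K B : 'M[C]_n) : 0 <= r -> lipmx r K ->
  N (K *m B) <= r * N B.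
Proof.
move=> r0 Kr; have [U [V [Uu Vu]]] := svd B.
have := @singvals_sorted _ _ B; have := @singvals_ge0 _ _ B.
move: (singvals B) => s s0 sdec ->.
rewrite mulmxA !(uinorm_mulUr _ Vu) (uinorm_mulUl _ Uu) mulmxA.
have KU := lipmx_mul1r Kr (lipmx_unitary Uu).
rewrite -[K *m U]mul1mx -dgmx1.
apply: le_trans (uinorm_dgmx_lip_dgmx _ _ _ _ r0 KU) _.
- by move=> i j _; rewrite !mxE.
- by move=> i; rewrite mxE.
- by move=> i j ij; rewrite !mxE sdec.
- by move=> i; rewrite mxE.
rewrite le_eqVlt; apply/orP; left; apply/eqP; congr (_ * N (dgmx _)).
by apply/rowP => j; rewrite !mxE mul1r.
Qed.

(** The mirror case, with [g = 1]. *)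
Lemma uinorm_lip_mulr (r : R) (K B : 'M[C]_n) : 0 <= r -> lipmx r K ->
  N (B *m K) <= r * N B.
Proof.
move=> r0 Kr; have [U [V [Uu Vu]]] := svd B.
have := @singvals_sorted _ _ B; have := @singvals_ge0 _ _ B.
move: (singvals B) => s s0 sdec ->.
rewrite -!mulmxA !(uinorm_mulUl _ Uu) (uinorm_mulUr _ Vu).
have VK := lipmx_mul1l (lipmx_unitary Vu) Kr.
rewrite -[V *m K]mulmx1 -dgmx1 mulmxA.
apply: le_trans (uinorm_dgmx_lip_dgmx _ _ _ _ r0 VK) _.
- by move=> i j ij; rewrite !mxE sdec.
- by move=> i; rewrite mxE.
- by move=> i j _; rewrite !mxE.
- by move=> i; rewrite mxE.
rewrite le_eqVlt; apply/orP; left; apply/eqP; congr (_ * N (dgmx _)).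
by apply/rowP => j; rewrite !mxE mulr1.
Qed.
End UnitarilyInvariantNorm.

(** * The algebraic identity between tangents, compressions and the residual *)

(** Here [c] and [s] stand for cosines and sines, [ci] inverts [c], and [si] inverts [s] only on its
    support, whose projection is [E]. The identity is first proved after multiplication by [s],
    which is then cancelled through [E], so that zero angles are allowed. *)
Lemma residual_factorization (C : numClosedFieldType) (d k : nat) (A : 'M[C]_d)
    (X Y Q F : 'M[C]_(d, k)) (c s ci si E M : 'M[C]_k) :
    A^t* = A -> X^t* *m X = 1%:M -> Y^t* *m Y = 1%:M -> X^t* *m Y = c ->
    A *m X = X *m (X^t* *m A *m X) -> c^t* = c -> s^t* = s ->
    Q *m s = Y - X *m c -> F *m s = Y *m c - X ->
    E *m Q^t* = Q^t* -> E *m F^t* = F^t* -> E = si *m s -> E *m s = s ->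
    c *m s = s *m c -> c *m E = E *m c -> ci *m c = 1%:M ->
    s *m s = 1%:M - c *m c -> M = Y^t* *m A *m Y ->
  ci *m s *m M = ci *m (Q^t* *m A *m Q) *m s - F^t* *m (A *m Y - Y *m M).
Proof.
move=> A_adj X_iso Y_iso XY A_X c_adj s_adj Qs Fs EQ EF Es Ess cs cE cic ss eM.
have YX : Y^t* *m X = c by rewrite -[LHS]trmxCK adjM trmxCK XY c_adj.
have [H eH] : exists H, H = X^t* *m A *m X by exists (X^t* *m A *m X).
rewrite -eH in A_X.
have XA : X^t* *m A = H *m X^t*.
  have := congr1 (fun B => B^t*) A_X; rewrite !adjM A_adj => ->.
  by rewrite eH !adjM trmxCK A_adj mulmxA.
have [L eL] : exists L, L = Q^t* *m A *m Q by exists (Q^t* *m A *m Q).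
rewrite -eL.
have [D eD] : exists D, D = A *m Y - Y *m M by exists (A *m Y - Y *m M).
rewrite -eD.
have XD : X^t* *m D = H *m c - c *m M.
  by rewrite eD mulmxBr !mulmxA XA XY -(mulmxA H) XY.
have YD : Y^t* *m D = 0 by rewrite eD mulmxBr !mulmxA -eM Y_iso mul1mx subrr.
(* Since [Y^* D = 0], only the summand [- X] of [F s = Y c - X] contributes. *)
have sFD : s *m (F^t* *m D) = c *m M - H *m c.
  by rewrite mulmxA -s_adj -adjM Fs adjB adjM c_adj mulmxBl -mulmxA YD mulmx0 XD sub0r opprB.
have sLs : s *m L *m s = M - c *m H *m c.
  have -> : s *m L *m s = (Q *m s)^t* *m (A *m (Q *m s)).
    by rewrite eL adjM s_adj !mulmxA.
  (* The columns of [Q s = Y - X c] are orthogonal to [X], while [A X = X H]; this removes one cross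
     term. *)
  have ZX : (Y^t* - c *m X^t*) *m X = 0.
    by rewrite mulmxBl YX -mulmxA X_iso mulmx1 subrr.
  rewrite Qs adjB adjM c_adj (mulmxBr A) (mulmxA A X) A_X -mulmxA mulmxBr.
  rewrite (mulmxA _ X) ZX mul0mx subr0 mulmxBl (mulmxA _ A) -eM.
  by rewrite -(mulmxA c (X^t*)) (mulmxA _ A) XA -(mulmxA H) XY mulmxA.
(* The three terms become [c c M - c H c], [- M + c H c] and [M - c c M]. *)
have sW : s *m (c *m (F^t* *m D) - L *m s + s *m M) = 0.
  rewrite mulmxDr mulmxBr !(mulmxA s) sLs ss -cs -(mulmxA c) sFD.
  rewrite mulmxBr mulmxBl mul1mx (mulmxA c c) (mulmxA c H) opprB.
  by rewrite !addrA !subrK subrr.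
(* Each term is fixed by [E = si s], hence vanishing after multiplication by [s] implies
   vanishing. *)
have EW : E *m (c *m (F^t* *m D) - L *m s + s *m M) =
    c *m (F^t* *m D) - L *m s + s *m M.
  have EL : E *m L = L by rewrite eL !mulmxA EQ.
  by rewrite mulmxDr mulmxBr (mulmxA E c) -cE -(mulmxA c) (mulmxA E) EF !(mulmxA E) EL Ess.
have : c *m (F^t* *m D) - L *m s + s *m M = 0 by rewrite -EW Es -mulmxA sW mulmx0.
move=> /eqP; rewrite addrC addr_eq0 opprB => /eqP sM.
by rewrite -mulmxA sM mulmxBr !mulmxA cic mul1mx.
Qed.

(** * Contractions, invertibility and the corner of a norm *)

Section TanTheta.
Variable R : realType.
Local Notation C := R[i].

(** The defect [|v|^2 - |Q^* v|^2] equals [|v - Q Q^* v|^2]. *)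
Lemma lipmx_partial_isometry_adj m n (Q : 'M[C]_(m, n)) (I : pred 'I_n) :
  Q^t* *m Q = indmx R I -> lipmx 1 (Q^t*).
Proof.
move=> QQ v; rewrite rmorph1 expr1n mul1r.
have IQ : indmx R I *m Q^t* = Q^t*.
  by rewrite -adj_indmx -adjM (partial_isometry_indmx QQ).
rewrite -subr_ge0; have -> : sqnm v - sqnm (Q^t* *m v) = sqnm (v - Q *m (Q^t* *m v)).
  rewrite /sqnm adjB !adjM trmxCK !(mulmxBl, mulmxBr) -!mulmxA.
  rewrite (mulmxA (Q^t*)) QQ (mulmxA (indmx R I)) IQ subrr subr0.
  by rewrite !mxE.
exact: sqnm_ge0.
Qed.

Lemma unitmx_inj n (M : 'M[C]_n) :
  (forall v : 'cV_n, M *m v = 0 -> v = 0) -> M \in unitmx.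
Proof.
move=> Minj; rewrite -unitmx_tr -row_free_unit; apply: inj_row_free => v vM.
by apply: trmx_inj; rewrite trmx0; apply: Minj; rewrite -[LHS]trmxK trmx_mul trmxK vM trmx0.
Qed.

Lemma sqnm_col_mx m n (u : 'cV[C]_m) (v : 'cV[C]_n) :
  sqnm (col_mx u v) = sqnm u + sqnm v.
Proof. by rewrite /sqnm tr_col_mx map_row_mx mul_row_col mxE. Qed.

Lemma corner_unitarymx k m (W : 'M[C]_k) :
  W \is unitarymx -> block_mx W 0 0 (1%:M : 'M_m) \is unitarymx.
Proof.
move=> /unitarymxP WW; apply/unitarymxP; rewrite tr_block_mx map_block_mx.
rewrite !trmx0 !map_mx0 adj1 mulmx_block WW !mulmx0 !mul0mx mulmx1 !addr0 add0r.
by rewrite -scalar_mx_block.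
Qed.

(** Lets the estimates for square matrices be applied to the [k] by [k] matrices of tangents and
    compressions. *)
Lemma uinorm_corner k m (N : 'M[C]_(k + m) -> R) : unitarily_invariant_norm N ->
  unitarily_invariant_norm (fun B : 'M[C]_k => N (block_mx B 0 0 0)).
Proof.
move=> hN; split => [A B|c B|B|U B V Uu Vu].
- by rewrite -[X in block_mx _ X _ _]addr0 -[X in block_mx _ _ X _]addr0
    -[X in block_mx _ _ _ X]addr0 -add_block_mx (uinorm_triangle hN).
- rewrite -[X in block_mx _ X _ _](scaler0 _ c) -[X in block_mx _ _ X _](scaler0 _ c)
    -[X in block_mx _ _ _ X](scaler0 _ c) -scale_block_mx.
  exact: (uinorm_scale hN).
- move/(uinorm_eq0 hN); rewrite -[0 in RHS](@block_mx0 _ k m k m).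
  by case/eq_block_mx.
rewrite -(uinorm_unitary hN (block_mx B 0 0 0) (corner_unitarymx m Uu) (corner_unitarymx m Vu)).
by rewrite !mulmx_block !(mulmx0, mul0mx, addr0, mul1mx, add0r).
Qed.

Lemma uinormN n (N : 'M[C]_n -> R) B : unitarily_invariant_norm N -> N (- B) = N B.
Proof.
move=> hN; rewrite -scaleN1r (uinorm_scale hN) /=.
by rewrite oppr0 expr0n addr0 sqrrN expr1n sqrtr1 mul1r.
Qed.

(** * The tangent bound for centred [A] when [X^* Y] is a diagonal matrix of increasing cosines *)

Section DiagonalCosine.
Variables (k m : nat) (A P : 'M[C]_(k + m)) (X Y : 'M[C]_(k + m, k)) (c : 'rV[R]_k).
Variables (r delta : R) (N : 'M[C]_(k + m) -> R).
Hypothesis A_adj : A^t* = A.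
Hypothesis X_iso : X^t* *m X = 1%:M.
Hypothesis Y_iso : Y^t* *m Y = 1%:M.
Hypothesis XY : X^t* *m Y = dgmx c.
Hypothesis c_gt0 : forall i, 0 < c 0 i.
Hypothesis c_incr : forall i j : 'I_k, (i <= j)%N -> c 0 i <= c 0 j.
Hypothesis A_X : A *m X = X *m (X^t* *m A *m X).
Hypothesis r_ge0 : 0 <= r.
Hypothesis delta_gt0 : 0 < delta.
Hypothesis A_perp : forall z, X^t* *m z = 0 -> sqnm (A *m z) <= r%:C ^+ 2 * sqnm z.
Let M := Y^t* *m A *m Y.
Hypothesis M_ge : forall v, (r + delta)%:C ^+ 2 * sqnm v <= sqnm (M *m v).
Hypothesis XP : X^t* *m P = X^t*.
Hypothesis YP : Y^t* *m P = Y^t*.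
Hypothesis N_uinorm : unitarily_invariant_norm N.

(** Sines and tangents of the angles with cosines [c]. Below, [Z] is the component of [Y] orthogonal
    to [X], and [G] is minus the component of [X] orthogonal to [Y]. *)
Let s : 'rV[R]_k := \row_j Num.sqrt (1 - c 0 j ^+ 2).
Let t : 'rV[R]_k := \row_j ((c 0 j)^-1 * s 0 j).
Let Z := Y - X *m dgmx c.
Let G := Y *m dgmx c - X.

Lemma gram_complX : Z^t* *m Z = 1%:M - dgmx c *m dgmx c.
Proof.
rewrite /Z adjB adjM adj_dgmx mulmxBl !mulmxBr Y_iso.
rewrite !mulmxA -(mulmxA _ (X^t*) X) X_iso mulmx1 -(mulmxA _ (X^t*) Y) XY.
have -> : Y^t* *m X = dgmx c by rewrite -[LHS]trmxCK adjM trmxCK XY adj_dgmx.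
by rewrite subrr subr0.
Qed.

Lemma gram_complY : G^t* *m G = 1%:M - dgmx c *m dgmx c.
Proof.
rewrite /G adjB adjM adj_dgmx mulmxBl !mulmxBr X_iso.
rewrite !mulmxA -(mulmxA _ (Y^t*) Y) Y_iso mulmx1 XY -(mulmxA _ (Y^t*) X).
have -> : Y^t* *m X = dgmx c by rewrite -[LHS]trmxCK adjM trmxCK XY adj_dgmx.
by rewrite subrr opprB add0r.
Qed.

(** The radicand is nonnegative because it is the squared norm of a column of [Z]. *)
Lemma sine_sqr j : s 0 j ^+ 2 = 1 - c 0 j ^+ 2.
Proof.
rewrite mxE sqr_sqrtr // -ler0c.
have -> : (1 - c 0 j ^+ 2)%:C = (Z^t* *m Z) j j.
  rewrite gram_complX dgmxM mxE [in RHS]mxE mxE !dgmxE mxE eqxx rmorphB rmorph1.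
  by rewrite -expr2 mulr1n.
rewrite mxE sumr_ge0 // => i _; rewrite mxE mxE -normCKC.
exact: exprn_ge0.
Qed.

Lemma gram_sine : 1%:M - dgmx c *m dgmx c = dgmx (\row_j (s 0 j ^+ 2)).
Proof.
rewrite dgmxM -dgmx1; apply/matrixP => i j.
rewrite mxE [X in _ + X]mxE !dgmxE -mulrnBl 3!mxE sine_sqr.
by rewrite rmorphB rmorph1 -expr2.
Qed.

Let Q := Z *m dgmx (\row_j (s 0 j)^-1).
Let F := G *m dgmx (\row_j (s 0 j)^-1).
Let E := indmx R [pred j | s 0 j != 0].

Lemma Q_partial_isometry : Q^t* *m Q = E /\ Q *m dgmx s = Z.
Proof. by apply: polar_factor; rewrite gram_complX gram_sine. Qed.

Lemma F_partial_isometry : F^t* *m F = E /\ F *m dgmx s = G.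
Proof. by apply: polar_factor; rewrite gram_complY gram_sine. Qed.

(** [Q] maps into the complement of [X], where [A] is bounded by [r], and both [Q] and [Q^*] are
    contractions. *)
Lemma compression_lipmx : lipmx r (Q^t* *m A *m Q).
Proof.
have [QQ _] := Q_partial_isometry.
have Q1 := lipmx_partial_isometry QQ; have Q1' := lipmx_partial_isometry_adj QQ.
have XQ : X^t* *m Q = 0.
  by rewrite /Q /Z mulmxA mulmxBr XY mulmxA X_iso mul1mx subrr mul0mx.
rewrite -mulmxA; apply: lipmx_mul1l Q1' _ => v.
rewrite -mulmxA; apply: le_trans (A_perp _) _.
  by rewrite mulmxA XQ mul0mx.
rewrite ler_wpM2l -?rmorphXn ?ler0c ?sqr_ge0 //.
by have := Q1 v; rewrite rmorph1 expr1n mul1r.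
Qed.

Lemma residual_identity :
  dgmx t *m M = dgmx (\row_j (c 0 j)^-1) *m (Q^t* *m A *m Q) *m dgmx s
    - F^t* *m (P *m (A *m Y - Y *m M)).
Proof.
have [QQ Qs] := Q_partial_isometry; have [FF Fs] := F_partial_isometry.
(* The columns of [F] are combinations of those of [X] and [Y], so [P] can be inserted before the
   residual. *)
have FP : F^t* *m P = F^t*.
  by rewrite /F /G adjM adjB adjM -mulmxA mulmxBl -mulmxA XP YP.
rewrite [F^t* *m _]mulmxA FP.
have -> : dgmx t = dgmx (\row_j (c 0 j)^-1) *m dgmx s.
  by rewrite dgmxM; congr dgmx; apply/rowP => j; rewrite [LHS]mxE [RHS]mxE [X in _ = X * _]mxE.
apply: (residual_factorization A_adj X_iso Y_iso XY A_X (adj_dgmx c) (adj_dgmx s) Qs Fs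
  (si := dgmx (\row_j (s 0 j)^-1)) (E := E)).
- by rewrite -{1}[E]adj_indmx -adjM (partial_isometry_indmx QQ).
- by rewrite -{1}[E]adj_indmx -adjM (partial_isometry_indmx FF).
- rewrite dgmxM; congr dgmx; apply/rowP => j; rewrite mxE [RHS]mxE [X in _ = X * _]mxE /=.
  by case: eqP => [->|/eqP s0]; rewrite ?mulr0 // mulVf.
- exact: indmx_support.
- exact: diag_mxC.
- exact: diag_mxC.
- rewrite dgmxM -dgmx1; congr dgmx; apply/rowP => j; rewrite !mxE mulVf //.
  by rewrite gt_eqF.
- by rewrite gram_sine dgmxM; congr dgmx; apply/rowP => j; rewrite [LHS]mxE [RHS]mxE expr2.
- by [].
Qed.

(** The identity bounds [N(T M)] by [r N(T)] plus the residual, while the lower bound on [M] gives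
    [(r + delta) N(T) <= N(T M)]; the terms [r N(T)] cancel. *)
Lemma tan_theta_diagonal :
  delta * N (block_mx (dgmx t) 0 0 0) <= N (row_mx (P *m (A *m Y - Y *m M)) 0).
Proof.
set D := P *m _.
pose Nk (B : 'M[C]_k) := N (block_mx B 0 0 0).
have hNk : unitarily_invariant_norm Nk by exact: uinorm_corner.
have rd : 0 < r + delta by exact: ltr_wpDl.
have rdC : 0 < (r + delta)%:C ^+ 2.
  by rewrite exprn_gt0 // -[ltLHS]/(0%:C) ltcR.
have Mu : M \in unitmx.
  apply: unitmx_inj => v Mv; apply: sqnm_eq0; apply/eqP; rewrite eq_le sqnm_ge0 andbT.
  by have := M_ge v; rewrite Mv sqnm0 pmulr_rle0.
(* The lower bound on [M], applied to [M^-1 v]. *)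
have Mlip : lipmx (r + delta)^-1 (invmx M).
  move=> v; have := M_ge (invmx M *m v); rewrite mulKVmx // fmorphV exprVn.
  by rewrite ler_pdivlMl.
have le1 : (r + delta) * Nk (dgmx t) <= Nk (dgmx t *m M).
  have := uinorm_lip_mulr hNk (dgmx t *m M) _ Mlip.
  by rewrite mulmxK // invr_ge0 (ltW rd) ler_pdivlMl //; apply.
(* As [c] increases, [c^-1] and [s] both decrease, as the weighted bound requires. *)
have le2 : Nk (dgmx (\row_j (c 0 j)^-1) *m (Q^t* *m A *m Q) *m dgmx s) <= r * Nk (dgmx t).
  have := uinorm_dgmx_lip_dgmx hNk (f := \row_j (c 0 j)^-1) (g := s) _ _ _ _ r_ge0
    compression_lipmx.
  have -> : \row_j ((\row_j (c 0 j)^-1) 0 j * s 0 j) = t.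
    by apply/rowP => j; rewrite mxE [RHS]mxE [X in X * _]mxE.
  apply => [i j ij|i|i j ij|i]; rewrite ?mxE.
  - by rewrite lef_pV2 ?posrE // c_incr.
  - by rewrite invr_ge0 ltW.
  - by rewrite ler_wsqrtr // lerD2l lerN2 lerXn2r ?nnegrE ?(ltW (c_gt0 _)) // c_incr.
  - exact: sqrtr_ge0.
have le3 : Nk (F^t* *m D) <= N (row_mx D 0).
  have [FF _] := F_partial_isometry.
  (* Zero rows make [F^*] square, so that it acts as a contraction on the padded residual. *)
  have Flip : lipmx 1 (col_mx (F^t*) (0 : 'M_(m, k + m))).
    move=> v; rewrite mul_col_mx sqnm_col_mx mul0mx sqnm0 addr0.
    exact: lipmx_partial_isometry_adj FF v.
  have := uinorm_lip_mull N_uinorm (row_mx D 0) ler01 Flip.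
  by rewrite mul_col_row !mulmx0 !mul0mx mul1r.
have : Nk (dgmx t *m M) <= r * Nk (dgmx t) + N (row_mx D 0).
  rewrite residual_identity; apply: le_trans (uinorm_triangle hNk _ _) _.
  by rewrite (uinormN _ hNk) lerD.
move: le1; rewrite /Nk mulrDl => le1 /(le_trans le1).
by rewrite lerD2l.
Qed.
End DiagonalCosine.
End TanTheta.

(** * Zero padding as block matrices *)

Section Padding.
Variables (R : realType) (k m : nat).

Lemma insub_lshift (i : 'I_k) : insub (val (lshift m i)) = Some i :> option 'I_k.
Proof. by rewrite /= valK. Qed.

Lemma insub_rshift (i : 'I_m) : insub (val (rshift k i)) = None :> option 'I_k.
Proof. by rewrite insubF //= ltnNge leq_addr. Qed.

Lemma pad_square (B : 'M[R[i]]_k) : pad (k + m) B = block_mx B 0 0 0.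
Proof.
apply/matrixP => a b; rewrite mxE -[a]splitK -[b]splitK.
case: (split a) (split b) => a' [] b' /=.
- by rewrite block_mxEul [insub _]insub_lshift [insub _]insub_lshift.
- by rewrite block_mxEur [insub _]insub_lshift [insub _]insub_rshift mxE.
- by rewrite block_mxEdl [insub _]insub_rshift mxE.
- by rewrite block_mxEdr [insub _]insub_rshift mxE.
Qed.

Lemma pad_cols (B : 'M[R[i]]_(k + m, k)) : pad (k + m) B = row_mx B 0.
Proof.
apply/matrixP => a b; rewrite mxE valK -[b]splitK.
case: (split b) => b' /=.
- by rewrite row_mxEl [insub _]insub_lshift.
- by rewrite row_mxEr [insub _]insub_rshift mxE.
Qed.
End Padding.

(** * Orthonormal bases, orthogonal complements and projections *)

Section OrthonormalBasis.
Variables (C : numClosedFieldType) (d : nat).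

Lemma mulmx_cV_inj m n (A B : 'M[C]_(m, n)) :
  (forall v : 'cV_n, A *m v = B *m v) -> A = B.
Proof.
move=> AB; apply/matrixP => i j; have /colP/(_ i) := AB (delta_mx j 0).
by rewrite -!colE !mxE.
Qed.

Lemma onb_mem m (M : 'M[C]_(d, m)) V (w : 'cV_m) :
  orthonormal_basis M V -> M *m w \in V.
Proof.
case=> _ <-; have -> : M *m w = \sum_j w j 0 *: col j M.
  apply/colP => i; rewrite mxE summxE; apply: eq_bigr => j _.
  by rewrite !mxE mulrC.
apply: memv_suml => j _.
by apply/memvZ/memv_span/mapP; exists j; rewrite ?mem_enum.
Qed.

(** The kernel of [M M^* - 1] contains the columns of [M], hence their span. *)
Lemma onb_proj m (M : 'M[C]_(d, m)) V (v : 'cV_d) :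
  orthonormal_basis M V -> v \in V -> M *m (M^t* *m v) = v.
Proof.
case=> MM <- vV; apply/eqP; rewrite -subr_eq0 mulmxA -[X in _ - X]mul1mx -mulmxBl.
have : (<<[seq col j M | j <- enum 'I_m]>> <= lker (linfun (mulmx (M *m M^t* - 1%:M)%R)))%VS.
  apply/span_subvP => _ /mapP[j _ ->]; rewrite memv_ker lfunE /=.
  by rewrite colE mulmxA mulmxBl mul1mx -(mulmxA M) MM mulmx1 subrr mul0mx.
by move/subvP/(_ v vV); rewrite memv_ker lfunE.
Qed.

Lemma onb_orthov m (M : 'M[C]_(d, m)) V (z : 'cV_d) :
  orthonormal_basis M V -> (z \in orthov (@dotcv C d) V) = (M^t* *m z == 0).
Proof.
move=> Monb; apply/mem_orthovP/eqP => [zV|Mz v vV].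
  apply/colP => i.
  have : dotcv z (M *m delta_mx i 0) = 0 := zV _ (onb_mem (delta_mx i 0) Monb).
  rewrite dotcvE adjM -mulmxA => zi; rewrite [RHS]mxE -zi.
  have -> : (delta_mx i 0 : 'cV[C]_m)^t* = delta_mx 0 i.
    by apply/rowP => j; rewrite !mxE rmorph_nat andbC.
  by rewrite -rowE [RHS]mxE.
rewrite -[LHS]/(dotcv z v).
by rewrite dotcvE -(onb_proj Monb vV) adjM -mulmxA Mz mulmx0 mxE.
Qed.

(** [v - P_W v] is orthogonal to [W], hence to [V], so [M^*] annihilates it. *)
Lemma adj_onb_orthoproj m (M : 'M[C]_(d, m)) V W :
  orthonormal_basis M V -> (V <= W)%VS -> M^t* *m orthoproj W = M^t*.
Proof.
move=> Monb VW; apply: mulmx_cV_inj => v; apply/esym/eqP.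
rewrite -subr_eq0 -mulmxA -mulmxBr -(onb_orthov _ Monb).
apply/mem_orthovP => w /(subvP VW) wW.
by have /mem_orthovP/(_ w wW) := orthoproj_compl W v.
Qed.
End OrthonormalBasis.

(** * Reduction to diagonal cosines *)

Section TanPrincipalAngles.
Variable R : realType.
Local Notation C := R[i].

(** At [c = 0] both sides take the default value [0] of a division by zero; the application has
    [0 < c]. *)
Lemma tan_acos (c : R) : 0 <= c <= 1 -> tan (acos c) = c^-1 * Num.sqrt (1 - c ^+ 2).
Proof.
move=> /andP[c0 c1]; have c11 : -1 <= c <= 1 by rewrite c1 (le_trans _ c0) // lerN10.
by rewrite /tan sin_acos // acosK // mulrC.
Qed.

(** The reversal of the singular values puts the cosines in the order of the principal angles. *)
Lemma svd_increasing k (B : 'M[C]_k) : exists W1 W2 : 'M[C]_k,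
  [/\ W1 \is unitarymx, W2 \is unitarymx &
      W1^t* *m B *m W2 = dgmx (\row_j (singvals B)`_(rev_ord j))].
Proof.
have [U [V [Uu Vu eB]]] := svd B.
pose rho : 'S_k := perm (@rev_ord_inj k).
have W1u := mul_unitarymx Uu (perm_unitarymx _ rho^-1).
have W2u := mul_unitarymx (unitarymx_adj Vu) (perm_unitarymx _ rho^-1).
exists (U *m perm_mx rho^-1), (V^t* *m perm_mx rho^-1); split; [exact W1u|exact W2u|].
have -> : dgmx (\row_j (singvals B)`_(rev_ord j)) =
    dgmx (\row_l (\row_j (singvals B)`_j) 0 (rho l)).
  by congr dgmx; apply/rowP => j; rewrite !mxE permE.
rewrite dgmx_perm adjM tr_perm_mx map_perm_mx invgK [in LHS]eB.
move: (dgmx _) (perm_mx _) (perm_mx _) => D Pm Pm'.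
rewrite -!mulmxA (mulmxA V) (unitarymxP Vu) mul1mx.
by rewrite (mulmxA _ U) (unitarymx_adjl Uu) mul1mx.
Qed.

(** Passing to the bases [X W1] and [Y W2] makes the cosines diagonal. The hypotheses carry over,
    and the residual only gains the unitary factor [W2]. *)
Lemma tan_principal_angles_le (k m : nat) (A P : 'M[C]_(k + m))
    (X Y : 'M[C]_(k + m, k)) (r delta : R) (N : 'M[C]_(k + m) -> R) :
    A^t* = A -> X^t* *m X = 1%:M -> Y^t* *m Y = 1%:M ->
    A *m X = X *m (X^t* *m A *m X) -> 0 <= r -> 0 < delta ->
    (forall z, X^t* *m z = 0 -> sqnm (A *m z) <= r%:C ^+ 2 * sqnm z) ->
    (forall v, (r + delta)%:C ^+ 2 * sqnm v <= sqnm (Y^t* *m A *m Y *m v)) ->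
    X^t* *m P = X^t* -> Y^t* *m P = Y^t* -> unitarily_invariant_norm N ->
  delta * norm_vec N (map_mx tan (principal_angles X Y)) <=
  norm_mx N (P *m (A *m Y - Y *m (Y^t* *m A *m Y))).
Proof.
move=> A_adj XX YY AX r0 delta0 Aperp MY XP YP hN.
have [W1 [W2 [W1u W2u W1B]]] := svd_increasing (X^t* *m Y).
set c := (\row_j _) in W1B.
(* All angles are below a right angle: if [X^* Y v = 0], then [A] is bounded by [r] at [Y v],
   whereas [Y^* A Y] expands [v] by at least [r + delta] and [Y^*] is a contraction. *)
have Binj (v : 'cV[C]_k) : X^t* *m Y *m v = 0 -> v = 0.
  rewrite -mulmxA => Bv; have := Aperp _ Bv; rewrite sqnm_isometry // => le1.
  have Y1 : lipmx 1 (Y^t*).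
    apply: (@lipmx_partial_isometry_adj _ _ _ Y predT).
    by rewrite YY -dgmx1; congr dgmx; apply/rowP => j; rewrite !mxE.
  have := Y1 (A *m (Y *m v)); rewrite rmorph1 expr1n mul1r !mulmxA => le2.
  rewrite mulmxA in le1; have := le_trans (le_trans (MY v) le2) le1.
  rewrite -subr_le0 -mulrBl.
  have : 0%:C < (r + delta)%:C ^+ 2 - r%:C ^+ 2.
    by rewrite -!rmorphXn -rmorphB ltcR subr_gt0 ltrXn2r ?nnegrE ?addr_ge0 ?(ltW delta0) // ltrDl.
  move=> /pmulr_rle0 -> sv; apply: sqnm_eq0; apply/eqP.
  by rewrite eq_le sv sqnm_ge0.
have c_gt0 i : 0 < c 0 i.
  rewrite mxE lt_neqAle singvals_ge0 andbT eq_sym; apply/negP => /eqP si.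
  (* A zero singular value would put the [i]-th column of [W2] into the kernel of [X^* Y]. *)
  have : W2 *m delta_mx i 0 = 0 :> 'cV[C]_k.
    apply: Binj; rewrite mulmxA.
    have := congr1 (fun B => W1 *m B *m delta_mx i 0) W1B.
    rewrite !mulmxA (unitarymxP W1u) mul1mx => ->.
    rewrite -mulmxA; have -> : dgmx c *m delta_mx i 0 = 0 :> 'cV[C]_k.
      rewrite -colE; apply/colP => j; rewrite mxE dgmxE [RHS]mxE mxE.
      by case: eqP => [->|_]; rewrite ?si ?rmorph0 ?mul0rn ?mulr0n.
    by rewrite mulmx0.
  move/(congr1 (mulmx (W2^t*))); rewrite mulmxA (unitarymx_adjl W2u) mul1mx mulmx0.
  by move=> /colP/(_ i)/eqP; rewrite !mxE !eqxx oner_eq0.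
have c_incr (i j : 'I_k) : (i <= j)%N -> c 0 i <= c 0 j.
  by move=> ij; rewrite !mxE singvals_sorted //= leq_sub2l.
have XX' := isometry_mulmx XX (unitarymx_adjl W1u).
have YY' := isometry_mulmx YY (unitarymx_adjl W2u).
have XY' : (X *m W1)^t* *m (Y *m W2) = dgmx c.
  by rewrite -W1B adjM -!mulmxA.
have AX' : A *m (X *m W1) = X *m W1 *m ((X *m W1)^t* *m A *m (X *m W1)).
  apply/eqP; rewrite -subr_eq0 (residual_mulmx _ _ W1u).
  by rewrite -AX subrr mul0mx.
have Aperp' (z : 'cV[C]_(k + m)) : (X *m W1)^t* *m z = 0 -> sqnm (A *m z) <= r%:C ^+ 2 * sqnm z.
  rewrite adjM -mulmxA => /(congr1 (mulmx W1)).
  by rewrite (mulmxA W1 (W1^t*)) (unitarymxP W1u) mul1mx mulmx0; exact: Aperp.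
have MY' (v : 'cV[C]_k) : (r + delta)%:C ^+ 2 * sqnm v <=
    sqnm ((Y *m W2)^t* *m A *m (Y *m W2) *m v).
  rewrite compression_mulmx -2!(mulmxA (W2^t*)) -(mulmxA _ W2 v).
  rewrite sqnm_isometry ?(unitarymx_adjl (unitarymx_adj W2u)) //.
  by rewrite -[in leLHS](sqnm_isometry v (unitarymx_adjl W2u)); exact: MY.
have XP' : (X *m W1)^t* *m P = (X *m W1)^t* by rewrite adjM -mulmxA XP.
have YP' : (Y *m W2)^t* *m P = (Y *m W2)^t* by rewrite adjM -mulmxA YP.
have := tan_theta_diagonal A_adj XX' YY' XY' c_gt0 c_incr AX' r0 delta0 Aperp' MY' XP' YP' hN.
rewrite /norm_vec /norm_mx pad_cols -/(dgmx _) pad_square.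
rewrite (residual_mulmx _ _ W2u).
rewrite (mulmxA P _ W2); set D := P *m (A *m Y - _).
have -> : row_mx (D *m W2) (0 : 'M_(_, m)) = row_mx D 0 *m block_mx W2 0 0 1%:M.
  by rewrite mul_row_block !mulmx0 mul0mx !addr0.
rewrite (uinorm_mulUr hN); last exact: corner_unitarymx.
congr (_ * N (block_mx (dgmx _) 0 0 0) <= _); apply/rowP => j.
rewrite [LHS]mxE [RHS]mxE [X in tan X]mxE.
have cj : (singvals (X^t* *m Y))`_(rev_ord j) = c 0 j by rewrite mxE.
rewrite cj tan_acos; first by rewrite [X in _ * X = _]mxE.
(* The bound [c_j <= 1] follows from [1 - c_j^2 = s_j^2]. *)
rewrite (ltW (c_gt0 j)) /= -(@ler_pXn2r _ 2) ?nnegrE ?ler01 ?(ltW (c_gt0 j)) //.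
by rewrite expr1n -subr_ge0 -(sine_sqr XX' YY' XY') sqr_ge0.
Qed.
End TanPrincipalAngles.

(** * Centring [A] and reading the two bounds off the separation property *)

Theorem corollary3p22 (R : realType) (d k : nat) (A : 'M[R[i]]_d)
    (calX calY : {vspace 'cV[R[i]]_d}) (delta : R)
    (X Y : 'M[R[i]]_(d, k)) (N : 'M[R[i]]_d -> R)
    (A_selfadjoint : A \is hermsymmx)
    (dim_calX : \dim calX = k) (dim_calY : \dim calY = k)
    (delta_gt0 : 0 < delta)
    (A_sep : DKN_separation k A calX calY delta)
    (X_onb : orthonormal_basis X calX) (Y_onb : orthonormal_basis Y calY)
    (N_uinorm : unitarily_invariant_norm N) :
  let R_Y := A *m Y - Y *m (Y^t* *m A *m Y) in
  delta * norm_vec N (map_mx tan (principal_angles X Y))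
    <= norm_mx N (orthoproj (calX + calY) *m R_Y).
Proof.
have [XX _] := X_onb; have [YY _] := Y_onb.
have le_kd : (k <= d)%N.
  rewrite -[leqLHS](mxrank1 R[i]) -XX.
  exact: leq_trans (mxrankM_maxr _ _) (rank_leq_row _).
(* Writing [d = k + m] turns padding into block matrices. *)
have [m dE] : exists m, d = (k + m)%N by exists (d - k)%N; rewrite subnKC.
subst d.
have [A_calX [Xp [Y0 [Xp_onb Y0_onb [a [b [le_ab eigX eigY]]]]]]] := A_sep.
have A_adj : A^t* = A by exact/hermsymmxP.
(* Centre and half-length of [[a, b]]. *)
pose cen : R := (a + b) / 2; pose r : R := (b - a) / 2.
have r0 : 0 <= r by rewrite divr_ge0 // subr_ge0.
pose A' := A - cen%:C%:M.
have A'_adj : A'^t* = A'.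
  rewrite adjB A_adj; congr (_ - _); rewrite tr_scalar_mx map_scalar_mx.
  by congr (_ %:M); apply/CrealP; rewrite complex_real.
have shift n (Q : 'M[R[i]]_(k + m, n)) :
    Q^t* *m Q = 1%:M -> Q^t* *m A' *m Q = Q^t* *m A *m Q - cen%:C%:M.
  move=> QQ; rewrite mulmxBr mulmxBl; congr (_ - _).
  by rewrite scalar_mxC -mulmxA QQ mulmx1.
have hermC n (Q : 'M[R[i]]_(k + m, n)) : Q^t* *m A *m Q \is hermsymmx.
  by apply/hermsymmxP; rewrite !adjM trmxCK A_adj mulmxA.
have A'X : A' *m X = X *m (X^t* *m A' *m X).
  have AX : A *m X = X *m (X^t* *m A *m X).
    apply: mulmx_cV_inj => v; rewrite -!mulmxA (onb_proj X_onb) //.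
    exact: A_calX (onb_mem v X_onb).
  by rewrite shift // mulmxBr -AX mulmxBl scalar_mxC.
have A'perp (z : 'cV[R[i]]_(k + m)) : X^t* *m z = 0 -> sqnm (A' *m z) <= r%:C ^+ 2 * sqnm z.
  have [XpXp _] := Xp_onb.
  have perpE (u : 'cV[R[i]]_(k + m)) : X^t* *m u = 0 -> Xp *m (Xp^t* *m u) = u.
    by move=> Xu; apply: (onb_proj Xp_onb); rewrite (onb_orthov _ X_onb) Xu.
  (* The complement of [X] is invariant under the self-adjoint [A'], so there [A'] acts as its
     compression by [Xp], with spectrum in [[-r, r]]. *)
  move=> Xz; have XAz : X^t* *m (A' *m z) = 0.
    rewrite mulmxA -[X^t* *m A']trmxCK adjM trmxCK A'_adj A'X.
    by rewrite adjM -mulmxA Xz mulmx0.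
  rewrite -(perpE _ XAz) sqnm_isometry // -{1}(perpE _ Xz) !mulmxA shift //.
  rewrite -(mulmxA _ _ z) -[in leRHS](perpE _ Xz) [in leRHS]sqnm_isometry //.
  apply: sqnm_hermitian_le => // i; have /andP[] := eigX i.
  by rewrite ler_norml /cen /r; lra.
have A'Y (v : 'cV[R[i]]_k) : (r + delta)%:C ^+ 2 * sqnm v <= sqnm (Y^t* *m A' *m Y *m v).
  have [Y0Y0 _] := Y0_onb.
  (* The separation property comes with its own basis [Y0] of the same subspace; the two bases
     differ by a unitary [U]. *)
  have [U eY] : exists U, Y = Y0 *m U.
    exists (Y0^t* *m Y); apply: mulmx_cV_inj => w.
    by rewrite -!mulmxA (onb_proj Y0_onb) //; exact: onb_mem Y_onb.
  have Uu : U \is unitarymx.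
    by apply: adjl_unitarymx; rewrite -YY eY adjM -mulmxA (mulmxA (Y0^t*)) Y0Y0 mul1mx.
  rewrite eY compression_mulmx -2!(mulmxA (U^t*)) -(mulmxA _ U v).
  rewrite sqnm_isometry ?(unitarymx_adjl (unitarymx_adj Uu)) // shift //.
  rewrite -[in leLHS](sqnm_isometry v (unitarymx_adjl Uu)).
  apply: sqnm_hermitian_ge => [||j]; [exact: hermC|by rewrite addr_ge0 // ltW|].
  by rewrite ler_normr /cen /r; apply/orP; case: (eigY j) => ?; [right|left]; lra.
have XP := adj_onb_orthoproj X_onb (addvSl calX calY).
have YP := adj_onb_orthoproj Y_onb (addvSr calX calY).
(* The shift by the centre leaves the residual unchanged. *)
cbv zeta; rewrite -(residual_shift A Y (Y^t* *m A *m Y) cen%:C) -shift //.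
exact: tan_principal_angles_le A'_adj XX YY A'X r0 delta_gt0 A'perp A'Y XP YP N_uinorm.
Qed.
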